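(* Let $z'=((z_i')_{i\in I},(z_j')_{j\in J})$ and $z''=((z_i'')_{i\in I},(z_j'')_{j\in J})$ be a pair of two-faced families in a non-commutative probability space $(\mathcal{A},\varphi)$. Then $z'$ and $z''$ are bi-free if and only if they are combinatorially-bi-free.
   Context: A non-commutative probability space $(\mathcal{A},\varphi)$ is a unital complex algebra $\mathcal A$ with a linear functional $\varphi$, $\varphi(1)=1$. $I$ and $J$ are disjoint index sets. A two-faced family $z=((z_i)_{i\in I},(z_j)_{j\in J})$ in $\mathcal A$ consists of elements $z_k\in\mathcal A$, $k\in I\sqcup J$; those with index in $I$ are ''left'', those with index in $J$ are ''right''. Free products. A vector space with specified state-vector $(\mathcal X,p,\xi)$ is a complex vector space $\mathcal X=\mathbb C\xi\oplus\mathring{\mathcal X}$, $\xi\neq0$, with $p$ the projection onto $\mathbb C\xi$ with kernel $\mathring{\mathcal X}$. $\mathcal L(\mathcal X)$ is the algebra of all linear maps on $\mathcal X$, with state $\varphi$ given by $p(T\xi)=\varphi(T)\xi$. The free product $(\mathcal X,p,\xi)=(\mathcal X',p',\xi')*(\mathcal X'',p'',\xi'')$ is $\mathcal X=\mathbb C\xi\oplus\bigoplus_{m\ge1}\bigoplus_{\delta_1\ne\delta_2\neq\cdots\ne\delta_m}\mathring{\mathcal X}^{\delta_1}\otimes\cdots\otimes\mathring{\mathcal X}^{\delta_m}$ ($\delta_t\in\{',''\}$, consecutive ones distinct), with $p$ the projection onto $\mathbb{C}\xi$ killing the other summands. For $\delta\in\{',''\}$, let $\mathcal X(\ell,\delta)$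 (resp. $\mathcal X(r,\delta)$) be the sum of $\mathbb C\xi$ and those tensor summands with $\delta_1\ne\delta$ (resp. $\delta_m\neq\delta$). Natural identifications (with $\xi^\delta\otimes x\mapsto x$, $x\otimes\xi^\delta\mapsto x$, $y\otimes \xi\mapsto y$, $\xi\otimes y\mapsto y$ for $y\in\mathring{\mathcal X}^\delta$, and concatenation otherwise) give isomorphisms $V_\delta:\mathcal X^\delta\otimes\mathcal X(\ell,\delta)\to\mathcal X$ and $W_\delta:\mathcal X(r,\delta)\otimes\mathcal X^\delta\to\mathcal X$. For $T\in\mathcal L(\mathcal X^\delta)$ the left and right representations are $\lambda^\delta(T)=V_\delta(T\otimes 1)V_\delta^{-1}$ and $\rho^\delta(T)=W_\delta(1\otimes T)W_\delta^{-1}$ in $\mathcal L(\mathcal X)$. Bi-freeness. $z',z''$ are bi-free if there exist such a free product and unital homomorphisms $l^\delta:\mathbb C\langle z_i^\delta: i\in I\rangle\to\mathcal L(\mathcal X^\delta)$, $r^\delta:\mathbb C\langle z_j^\delta: j\in J\rangle\to\mathcal L(\mathcal X^\delta)$, $\delta\in\{',''\}$ (defined on algebras of non-commutative polynomials in formal variables), such that the families $((\lambda^\delta(l^\delta(z_i^\delta)))_{i\in I},(\rho^\delta(r^\delta(z_j^\delta)))_{j\in J})$, $\delta\in\{',''\}$, have in $(\mathcal L(\mathcal X),\varphi)$ the same joint distribution (all joint mixed moments of the two families together) as $z'$ and $z''$ in $(\mathcal A,\varphi)$. Bi-non-crossing partitions. For $\chi:\{1,\dots,n\}\to\{\ell,r\}$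 write $\chi^{-1}(\ell)=\{i_1<\cdots<i_p\}$, $\chi^{-1}(r)=\{j_1<\cdots<j_{n-p}\}$ and let $s_\chi\in S_n$ be $s_\chi(k)=i_k$ for $k\le p$, $s_\chi(k)=j_{n+1-k}$ for $k>p$. $BNC(\chi)$ is the set of partitions $\pi$ of $\{1,\dots,n\}$ such that $s_\chi^{-1}\cdot\pi$ (applying $s_\chi^{-1}$ to every block) is non-crossing. Cumulants. The $(\ell,r)$-cumulant functionals $\kappa_\chi:\mathcal A^n\to\mathbb C$ ($n\ge1$, $\chi:\{1,\dots,n\}\to\{\ell,r\}$) are the multilinear functionals uniquely determined by $\varphi(a_1\cdots a_n)=\sum_{\pi\in BNC(\chi)}\prod_{V\in\pi}\kappa_{\chi|_V}((a_1,\dots,a_n)|V)$ for all $n,\chi$, $a_1,\dots,a_n\in\mathcal{A}$, where for $V=\{v_1<\cdots<v_m\}$, $\chi|_V(t)=\chi(v_t)$ and $(a_1,\dots,a_n)|V=(a_{v_1},\dots,a_{v_m})$. Combinatorial bi-freeness. $z',z''$ are combinatorially-bi-free if $\kappa_\chi(z_{\alpha(1)}^{\epsilon_1},\dots,z_{\alpha(n)}^{\epsilon_n})=0$ whenever $n\ge 1$, $\alpha:\{1,\dots,n\}\to I\sqcup J$, $\chi:\{1,\dots,n\}\to\{\ell,r\}$ satisfies $\alpha^{-1}(I)=\chi^{-1}(\{\ell\})$, and $\epsilon\in\{',''\}^n$ is non-constant. *)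

(* Defs.v *)
From HB Require Import structures.
From mathcomp Require Import all_boot all_order all_algebra perm.
From mathcomp Require Import boolp finmap monalg.

Set Implicit Arguments.
Unset Strict Implicit.
Unset Printing Implicit Defensive.

(* Everything is done over a field K, to be instantiated by the complex
   numbers. Booleans encode the two binary labels: in "d : bool", false stands
   for ' and true for ''; in "chi : 'I_n -> bool", true stands for "left". *)

Import GRing.Theory.
Local Open Scope ring_scope.
Local Open Scope quotient_scope.

Section Linear.
Variable K : fieldType.

Definition mklin (U V : lmodType K) (f : U -> V) (hf : linear f) :
    {linear U -> V} :=
  HB.pack f (GRing.isLinear.Build K U V *:%R f hf).

Lemma linv_subproof (U V : lmodType K) (f : {linear U -> V}) :
  bijective f -> exists g : {linear V -> U}, cancel f g /\ cancel g f.
Proof.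
case=> g fK gK; have gl : linear g by exact: can2_linear fK gK.
by exists (mklin gl).
Qed.

Definition linv (U V : lmodType K) (f : {linear U -> V}) (hf : bijective f) :
  {linear V -> U} := projT1 (cid (linv_subproof hf)).

Lemma linvK (U V : lmodType K) (f : {linear U -> V}) (hf : bijective f) :
  cancel f (linv hf).
Proof. by rewrite /linv; case: cid => g []. Qed.

Lemma linvKV (U V : lmodType K) (f : {linear U -> V}) (hf : bijective f) :
  cancel (linv hf) f.
Proof. by rewrite /linv; case: cid => g []. Qed.

Lemma linear_eq (U V : lmodType K) (f g : {linear U -> V}) : f =1 g -> f = g.
Proof.
case: f g => [f hf] [g hg] /= /funext fg; case: _ / fg in hg *.
congr GRing.Linear.Pack; case: hf hg => [[a1] [b1]] [[a2] [b2]].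
by rewrite (Prop_irrelevance a1 a2) (Prop_irrelevance b1 b2).
Qed.
End Linear.

Section Quotient.
Variables (K : fieldType) (V : lmodType K) (S : V -> Prop).

Definition is_submod (P : V -> Prop) :=
  P 0 /\ forall c x y, P x -> P y -> P (c *: x + y).

Definition span_of : {pred V} := fun v =>
  `[< forall P, is_submod P -> (forall s, S s -> P s) -> P v >].

Lemma span_ofP v : reflect
  (forall P, is_submod P -> (forall s, S s -> P s) -> P v) (v \in span_of).
Proof. exact: asboolP. Qed.

Lemma span_of_submod : is_submod (fun v => v \in span_of).
Proof.
split=> [|c x y /span_ofP hx /span_ofP hy]; apply/span_ofP => P hP hS.
  by case: hP.
by case: (hP) => _; apply; [apply: hx|apply: hy].
Qed.

Lemma sub_span_of v : S v -> v \in span_of.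
Proof. by move=> Sv; apply/span_ofP => P _; apply. Qed.

Lemma span_of_zmod : zmod_closed span_of.
Proof.
have [h0 hl] := span_of_submod; split=> // x y hx hy.
by rewrite addrC -scaleN1r; exact: hl.
Qed.

HB.instance Definition _ := GRing.isZmodClosed.Build V span_of span_of_zmod.

(* V modulo the linear span of S *)
Definition quot_of : Type := Quotient.quot (span_of : zmodClosed V).
HB.instance Definition _ := GRing.Zmodule.on quot_of.
HB.instance Definition _ := EqQuotient.on quot_of.

Definition qpi (v : V) : quot_of := \pi_(quot_of) v.

Lemma qpiP x y : qpi x = qpi y <-> x - y \in span_of.
Proof. by rewrite Quotient.idealrBE; split=> [/eqP//|/eqP]. Qed.

Lemma qpiD : {morph qpi : x y / x + y}.
Proof. by move=> x y; rewrite /qpi !piE. Qed.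

Lemma qpi_repr (q : quot_of) : qpi (repr q) = q.
Proof. exact: reprK. Qed.

Definition qscale (c : K) (q : quot_of) : quot_of := qpi (c *: repr q).

Lemma qscaleE c v : qscale c (qpi v) = qpi (c *: v).
Proof.
apply/qpiP; rewrite -scalerBr -[_ *: _]addr0.
have [h0 hl] := span_of_submod.
by apply: hl => //; apply/qpiP; rewrite qpi_repr.
Qed.

Lemma qscaleA a b q : qscale a (qscale b q) = qscale (a * b) q.
Proof. by rewrite -(qpi_repr q) !qscaleE scalerA. Qed.
Lemma qscale1 : left_id 1 qscale.
Proof. by move=> q; rewrite -(qpi_repr q) qscaleE scale1r. Qed.
Lemma qscaleDr : right_distributive qscale +%R.
Proof.
by move=> c p q; rewrite -(qpi_repr p) -(qpi_repr q) -qpiD !qscaleE scalerDr qpiD.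
Qed.
Lemma qscaleDl q : {morph qscale^~ q : a b / a + b}.
Proof. by move=> a b /=; rewrite -(qpi_repr q) !qscaleE scalerDl qpiD. Qed.

HB.instance Definition _ :=
  GRing.Zmodule_isLmodule.Build K quot_of qscaleA qscale1 qscaleDr qscaleDl.

Lemma qpi_linear : linear qpi.
Proof. by move=> c x y; rewrite qpiD -qscaleE. Qed.
HB.instance Definition _ := GRing.isLinear.Build K V quot_of *:%R qpi qpi_linear.

Section Lift.
Variables (W : lmodType K) (f : {linear V -> W}) (f0 : forall s, S s -> f s = 0).

Definition qlift_fun (q : quot_of) : W := f (repr q).

Lemma qlift_funE v : qlift_fun (qpi v) = f v.
Proof.
apply/eqP; rewrite -subr_eq0 -linearB /=; apply/eqP.
have /span_ofP/(_ (fun v => f v = 0)) : repr (qpi v) - v \in span_of.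
  by apply/qpiP; rewrite qpi_repr.
apply=> //; split=> [|c x y fx fy]; first exact: linear0.
by rewrite linearP fx fy scaler0 addr0.
Qed.

Lemma qlift_linear : linear qlift_fun.
Proof.
move=> c p q; rewrite -(qpi_repr p) -(qpi_repr q) -linearP !qlift_funE.
exact: linearP.
Qed.

Definition qlift : {linear quot_of -> W} := mklin qlift_linear.

Lemma qliftE v : qlift (qpi v) = f v.
Proof. exact: qlift_funE. Qed.
End Lift.
End Quotient.

Section FreeLift.
Variables (K : fieldType) (T : choiceType) (W : lmodType K) (h : T -> W).

Definition flift_fun (g : {malg K[T]}) : W := \sum_(t <- msupp g) g@_t *: h t.

Lemma flift_funEw (d : {fset T}) g : (msupp g `<=` d)%fset ->
  flift_fun g = \sum_(t <- d) g@_t *: h t.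
Proof.
move=> le; rewrite [LHS](big_fset_incl _ le) => //= x xd /mcoeff_outdom ->.
by rewrite scale0r.
Qed.

Lemma flift_linear : linear flift_fun.
Proof.
move=> c x y; pose d := (msupp x `|` msupp y `|` msupp (c *: x + y))%fset.
rewrite !(@flift_funEw d); first last.
- exact: fsubsetUr.
- exact: fsubset_trans (fsubsetUl _ _) (fsubsetUl _ _).
- exact: fsubset_trans (fsubsetUr _ _) (fsubsetUl _ _).
rewrite scaler_sumr -big_split /=; apply: eq_bigr => t _.
by rewrite mcoeffD mcoeffZ scalerDl scalerA.
Qed.

Definition flift : {linear {malg K[T]} -> W} := mklin flift_linear.

Lemma fliftE t : flift << t >> = h t.
Proof.
rewrite /= (@flift_funEw [fset t]%fset) ?msuppU_le //.
by rewrite big_seq_fset1 mcoeffUU scale1r.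
Qed.
End FreeLift.

Lemma free_ext (K : fieldType) (T : choiceType) (W : lmodType K)
  (f g : {linear {malg K[T]} -> W}) : (forall t, f << t >> = g << t >>) -> f =1 g.
Proof.
move=> fg x; rewrite (monalgE x) !linear_sum; apply: eq_bigr => t _.
have -> : << x@_t *g t >> = x@_t *: << t >> :> {malg K[T]}.
  by apply/malgP => k; rewrite mcoeffZ !mcoeffU mulrnAr mulr1.
by rewrite !linearZ fg.
Qed.

Section Tensor.
Variable K : fieldType.
Implicit Types U V W : lmodType K.

Definition bilinear_rel U V (v : {malg K[(U * V)%type]}) : Prop :=
  (exists c x x' y, v = << (c *: x + x', y) >> - c *: << (x, y) >> - << (x', y) >>)
  \/ (exists c x y y', v = << (x, c *: y + y') >> - c *: << (x, y) >> - << (x, y') >>).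

(* the free vector space on U * V modulo the bilinearity relations *)
Definition tensor U V : lmodType K := quot_of (@bilinear_rel U V).

Definition tens U V (x : U) (y : V) : tensor U V := qpi _ << (x, y) >>.

Lemma tens_linearl U V (y : V) : linear (fun x : U => tens x y).
Proof.
move=> c x x'; apply/eqP; rewrite -subr_eq0 opprD addrA -!linearZ -!linearB /=.
rewrite -(linear0 (qpi (@bilinear_rel U V))); apply/eqP/qpiP; rewrite subr0.
by apply: sub_span_of; left; exists c, x, x', y.
Qed.

Lemma tens_linearr U V (x : U) : linear (tens x : V -> _).
Proof.
move=> c y y'; apply/eqP; rewrite -subr_eq0 opprD addrA -!linearZ -!linearB /=.
rewrite -(linear0 (qpi (@bilinear_rel U V))); apply/eqP/qpiP; rewrite subr0.
by apply: sub_span_of; right; exists c, x, y, y'.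
Qed.

Section Tlift.
Variables (U V W : lmodType K) (b : U -> V -> W).
Hypotheses (bl : forall y, linear (b^~ y)) (br : forall x, linear (b x)).

Lemma tlift_subproof v :
  bilinear_rel v -> flift (fun p : U * V => b p.1 p.2) v = 0.
Proof.
case=> [[c [x [x' [y ->]]]]|[c [x [y [y' ->]]]]];
  by rewrite !linearB linearZ !fliftE /= ?bl ?br -addrA -opprD subrr.
Qed.

Definition tlift : {linear tensor U V -> W} := qlift tlift_subproof.

Lemma tliftE x y : tlift (tens x y) = b x y.
Proof. by rewrite qliftE fliftE. Qed.
End Tlift.

Lemma tensor_ext U V W (f g : {linear tensor U V -> W}) :
  (forall x y, f (tens x y) = g (tens x y)) -> f =1 g.
Proof.
move=> fg q; rewrite -(qpi_repr q).
pose f' : {linear {malg K[(U * V)%type]} -> W} := f \o qpi (@bilinear_rel U V).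
pose g' : {linear {malg K[(U * V)%type]} -> W} := g \o qpi (@bilinear_rel U V).
by rewrite -[LHS]/(f' _) -[RHS]/(g' _); apply: free_ext => -[x y]; exact: fg.
Qed.

Section Tmap.
Variables (U V U' V' : lmodType K) (f : {linear U -> U'}) (g : {linear V -> V'}).

Lemma tmap_linearl y : linear (fun x => tens (f x) (g y)).
Proof. by move=> c x x'; rewrite linearP tens_linearl. Qed.
Lemma tmap_linearr x : linear (fun y => tens (f x) (g y)).
Proof. by move=> c y y'; rewrite linearP tens_linearr. Qed.

Definition tmap : {linear tensor U V -> tensor U' V'} :=
  tlift tmap_linearl tmap_linearr.

Lemma tmapE x y : tmap (tens x y) = tens (f x) (g y).
Proof. exact: tliftE. Qed.
End Tmap.
End Tensor.

Section DirectSum.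
Variables (K : fieldType) (D : choiceType) (P : pred D) (T : D -> lmodType K).

(* The direct sum of the T d over the d satisfying P: finitely supported
   families, indexed by all of D but vanishing where P fails. Accordingly the
   injection [dinj d] below is 0 when P d fails. *)
Record dsum := DSum {
  dval :> forall d, T d;
  dsumP : exists2 s : seq D, all P s & forall d, d \notin s -> dval d = 0 }.

Lemma dsum_ext (f g : dsum) : (forall d, f d = g d) -> f = g.
Proof.
case: f g => [f hf] [g hg] /= fg.
have {}fg : f = g by apply: functional_extensionality_dep.
by case: _ / fg in hg *; congr DSum; exact: Prop_irrelevance.
Qed.

HB.instance Definition _ := gen_eqMixin dsum.
HB.instance Definition _ := gen_choiceMixin dsum.

Lemma dsum0_subproof :
  exists2 s : seq D, all P s & forall d, d \notin s -> (0 : T d) = 0.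
Proof. by exists [::]. Qed.
Definition dsum0 := DSum dsum0_subproof.

Lemma dsumD_subproof (f g : dsum) :
  exists2 s : seq D, all P s & forall d, d \notin s -> f d + g d = 0.
Proof.
case: (dsumP f) (dsumP g) => s sP fs [t tP gt].
exists (s ++ t) => [|d]; first by rewrite all_cat sP.
by rewrite mem_cat negb_or => /andP[/fs-> /gt->]; rewrite addr0.
Qed.
Definition dsumD f g := DSum (dsumD_subproof f g).

Lemma dsumZ_subproof (c : K) (f : dsum) :
  exists2 s : seq D, all P s & forall d, d \notin s -> c *: f d = 0.
Proof. by case: (dsumP f) => s sP fs; exists s => // d /fs->; rewrite scaler0. Qed.
Definition dsumZ c f := DSum (dsumZ_subproof c f).

Lemma dsumDA : associative dsumD.
Proof. by move=> f g h; apply: dsum_ext => d /=; rewrite addrA. Qed.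
Lemma dsumDC : commutative dsumD.
Proof. by move=> f g; apply: dsum_ext => d /=; rewrite addrC. Qed.
Lemma dsum0D : left_id dsum0 dsumD.
Proof. by move=> f; apply: dsum_ext => d /=; rewrite add0r. Qed.
Lemma dsumND : left_inverse dsum0 (dsumZ (- 1)) dsumD.
Proof. by move=> f; apply: dsum_ext => d /=; rewrite scaleN1r addNr. Qed.

HB.instance Definition _ := GRing.isZmodule.Build dsum dsumDA dsumDC dsum0D dsumND.

Lemma dsumZA a b f : dsumZ a (dsumZ b f) = dsumZ (a * b) f.
Proof. by apply: dsum_ext => d /=; rewrite scalerA. Qed.
Lemma dsum1Z : left_id 1 dsumZ.
Proof. by move=> f; apply: dsum_ext => d /=; rewrite scale1r. Qed.
Lemma dsumZDr : right_distributive dsumZ +%R.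
Proof. by move=> c f g; apply: dsum_ext => d /=; rewrite scalerDr. Qed.
Lemma dsumZDl f : {morph dsumZ^~ f : a b / a + b}.
Proof. by move=> a b; apply: dsum_ext => d /=; rewrite scalerDl. Qed.

HB.instance Definition _ :=
  GRing.Zmodule_isLmodule.Build K dsum dsumZA dsum1Z dsumZDr dsumZDl.

Lemma dsumDE (f g : dsum) d : (f + g) d = f d + g d. Proof. by []. Qed.
Lemma dsumZE c (f : dsum) d : (c *: f) d = c *: f d. Proof. by []. Qed.

Definition dpr_fun d (f : dsum) : T d := f d.
Lemma dpr_linear d : linear (dpr_fun d). Proof. by []. Qed.
Definition dpr d : {linear dsum -> T d} := mklin (@dpr_linear d).

Definition dinj_val d (x : T d) d' : T d' :=
  if P d then if d =P d' is ReflectT e then ecast i (T i) e x else 0 else 0.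

Lemma dinj_val_id d x : dinj_val x d = if P d then x else 0.
Proof.
rewrite /dinj_val; case: ifP => // Pd.
by case: eqP => // e; rewrite (eq_axiomK e).
Qed.

Lemma dinj_val_neq d x d' : d != d' -> dinj_val (x : T d) d' = 0.
Proof. by rewrite /dinj_val; case: ifP => // Pd; case: eqP. Qed.

Lemma dinj_subproof d (x : T d) :
  exists2 s : seq D, all P s & forall d', d' \notin s -> dinj_val x d' = 0.
Proof.
exists [seq i <- [:: d] | P i]; first exact: filter_all.
move=> d'; rewrite /=; case: ifP => [Pd|Pd _]; last by rewrite /dinj_val Pd.
by rewrite inE eq_sym; exact: dinj_val_neq.
Qed.

Definition dinj_fun d x := DSum (@dinj_subproof d x).

Lemma dinj_linear d : linear (@dinj_fun d).
Proof.
move=> c x y; apply: dsum_ext => d'; rewrite dsumDE dsumZE /=.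
have [<-|nd] := eqVneq d d'; last by rewrite !dinj_val_neq // scaler0 addr0.
by rewrite !dinj_val_id; case: ifP => // _; rewrite scaler0 addr0.
Qed.

Definition dinj d : {linear T d -> dsum} := mklin (@dinj_linear d).

Lemma dinj_id d x : P d -> dinj d x d = x.
Proof. by move=> Pd; rewrite /= dinj_val_id Pd. Qed.

Lemma dinj_neq d x d' : d != d' -> dinj d x d' = 0.
Proof. exact: dinj_val_neq. Qed.

Lemma dinj_out d x : ~~ P d -> dinj d x = 0.
Proof. by move=> /negbTE nP; apply: dsum_ext => d'; rewrite /= /dinj_val nP. Qed.

Section Dlift.
Variables (W : lmodType K) (g : forall d, {linear T d -> W}).

Definition dlift_fun (f : dsum) : W :=
  \sum_(d <- undup (projT1 (cid2 (dsumP f)))) g d (f d).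

Lemma dlift_funE (f : dsum) (s : seq D) : uniq s -> (forall d, d \notin s -> f d = 0) ->
  dlift_fun f = \sum_(d <- s) g d (f d).
Proof.
rewrite /dlift_fun; case: cid2 => t /= _ ft us fs.
rewrite (bigID (fun d => f d != 0)) /= [X in _ + X]big1 ?addr0; last first.
  by move=> d /negPn/eqP->; rewrite linear0.
rewrite [RHS](bigID (fun d => f d != 0)) /= [X in _ + X]big1 ?addr0; last first.
  by move=> d /negPn/eqP->; rewrite linear0.
rewrite -big_filter -[RHS]big_filter; apply: perm_big; apply: uniq_perm.
- by rewrite filter_uniq ?undup_uniq.
- by rewrite filter_uniq.
move=> d; rewrite !mem_filter mem_undup; case: eqP => //= fd.
transitivity true; last apply/esym; apply/negPn/negP; first by move=> /ft.
by move=> /fs.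
Qed.

Lemma dlift_linear : linear dlift_fun.
Proof.
move=> c x y; pose sup (f : dsum) := projT1 (cid2 (dsumP f)).
have supP (f : dsum) d : d \notin sup f -> f d = 0 by rewrite /sup; case: cid2 => s /= _; apply.
pose s := undup (sup x ++ sup y).
have us : uniq s by exact: undup_uniq.
have xs d : d \notin s -> x d = 0.
  by rewrite mem_undup mem_cat negb_or => /andP[/supP].
have ys d : d \notin s -> y d = 0.
  by rewrite mem_undup mem_cat negb_or => /andP[_ /supP].
rewrite !(@dlift_funE _ s) //; last first.
  by move=> d ds; rewrite dsumDE dsumZE xs ?ys // scaler0 addr0.
rewrite scaler_sumr -big_split /=; apply: eq_bigr => d _.
exact: linearP.
Qed.

Definition dlift : {linear dsum -> W} := mklin dlift_linear.

Lemma dliftE d x : P d -> dlift (dinj d x) = g d x.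
Proof.
move=> Pd; rewrite /= (@dlift_funE _ [:: d]) //; last first.
  by move=> d'; rewrite inE eq_sym; exact: dinj_val_neq.
by rewrite big_seq1 dinj_id.
Qed.
End Dlift.

Lemma dsum_sum (f : dsum) :
  exists2 s : seq D, all P s & f = \sum_(d <- s) dinj d (f d).
Proof.
case: (dsumP f) => s sP fs; exists (undup s).
  by apply/allP => d; rewrite mem_undup; exact/allP.
apply: dsum_ext => d; rewrite -[RHS]/(dpr d _) linear_sum /=.
have [ds|ds] := boolP (d \in s); last first.
  rewrite fs // big_seq big1 // => d'; rewrite mem_undup => d's.
  by apply: dinj_val_neq; apply: contraNneq ds => <-.
rewrite (bigD1_seq d) ?mem_undup ?undup_uniq //= big1 => [|d' nd]; last first.
  exact: dinj_val_neq.
by rewrite addr0 -[RHS]/(dinj d (f d) d) dinj_id //; exact: (allP sP).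
Qed.

Lemma dsum_linear_ext (W : lmodType K) (f g : {linear dsum -> W}) :
  (forall d x, P d -> f (dinj d x) = g (dinj d x)) -> f =1 g.
Proof.
move=> fg x; have [s sP ->] := dsum_sum x; rewrite !linear_sum !big_seq.
by apply: eq_bigr => d ds; apply: fg; exact: (allP sP).
Qed.
End DirectSum.

Section PointedSpace.
Variable K : fieldType.

(* A vector space with specified state-vector: [pproj] is a projection onto the
   line K * pvec, and X = K * pvec (+) ker pproj. *)
Record pspace := PSpace {
  pcar :> lmodType K;
  pvec : pcar;
  pproj : {linear pcar -> pcar};
  pvec_neq0 : pvec != 0;
  pproj_vec : pproj pvec = pvec;
  pproj_line : forall x, exists c, pproj x = c *: pvec }.

Variable X : pspace.
Let xi : X := pvec X.

(* the coordinate of [pproj X x] along the state-vector *)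
Definition pcoef_fun (x : X) : K := projT1 (cid (pproj_line x)).

Lemma pcoef_funE x : pproj X x = pcoef_fun x *: xi.
Proof. by rewrite /pcoef_fun; case: cid. Qed.

Lemma pcoef_uniq c x : pproj X x = c *: xi -> pcoef_fun x = c.
Proof.
rewrite pcoef_funE => /eqP; rewrite -subr_eq0 -scalerBl scaler_eq0.
by rewrite (negbTE (pvec_neq0 X)) orbF subr_eq0 => /eqP.
Qed.

Lemma pcoef_linear : scalar pcoef_fun.
Proof.
by move=> c x y; apply: pcoef_uniq; rewrite linearP !pcoef_funE scalerA -scalerDl.
Qed.

Definition pcoef : {scalar X} :=
  HB.pack pcoef_fun (GRing.isLinear.Build K X K *%R pcoef_fun pcoef_linear).

Lemma pcoefE x : pproj X x = pcoef x *: xi. Proof. exact: pcoef_funE. Qed.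

Lemma pcoef_vec : pcoef xi = 1.
Proof. by apply: pcoef_uniq; rewrite pproj_vec scale1r. Qed.

Definition pker_pred : {pred X} := fun x => pproj X x == 0.

Lemma pker_submod : submod_closed pker_pred.
Proof.
split; rewrite ?inE /pker_pred; first by rewrite unfold_in linear0.
by move=> c x y; rewrite !unfold_in linearP => /eqP-> /eqP->; rewrite scaler0 addr0.
Qed.
HB.instance Definition _ := GRing.isSubmodClosed.Build K X pker_pred pker_submod.

(* the distinguished complement of the line, ker pproj *)
Record pker := PKer { pker_val :> X; pkerP : pker_val \in pker_pred }.
HB.instance Definition _ := [isSub for pker_val].
HB.instance Definition _ := [Choice of pker by <:].
HB.instance Definition _ := [SubChoice_isSubLmodule of pker by <:].

Lemma pker_proj (x : pker) : pproj X (val x) = 0.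
Proof. by case: x => x xP; exact/eqP. Qed.

Lemma pcoef_ker (x : pker) : pcoef (val x) = 0.
Proof. by apply: pcoef_uniq; rewrite pker_proj scale0r. Qed.

Lemma pcomp_subproof x : x - pproj X x \in pker_pred.
Proof.
by rewrite unfold_in linearB /= pcoefE linearZ /= pproj_vec subrr.
Qed.

Definition pcomp_fun x : pker := PKer (pcomp_subproof x).
Lemma pcomp_linear : linear pcomp_fun.
Proof.
by move=> c x y; apply: val_inj; rewrite !linearP /= linearP /= scalerBr opprD addrACA.
Qed.

Definition pcomp : {linear X -> pker} := mklin pcomp_linear.

Lemma pcompE x : val (pcomp x) = x - pproj X x. Proof. by []. Qed.

Lemma pcomp_ker (x : pker) : pcomp (val x) = x.
Proof. by apply: val_inj; rewrite pcompE pker_proj subr0. Qed.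

Lemma pcomp_vec : pcomp xi = 0.
Proof. by apply: val_inj; rewrite pcompE pproj_vec subrr. Qed.

Lemma pdecomp x : x = pcoef x *: xi + val (pcomp x).
Proof. by rewrite pcompE -pcoefE addrC subrK. Qed.

(* the algebra of all linear maps on X, with composition as product *)
Definition Lop : Type := {linear X -> X}.
HB.instance Definition _ := gen_eqMixin Lop.
HB.instance Definition _ := gen_choiceMixin Lop.

Implicit Types S T : Lop.

Definition lop0 : Lop := \0.
Definition lopD S T : Lop := (S : {linear X -> X}) \+ (T : {linear X -> X}).
Definition lopN S : Lop := \- (S : {linear X -> X}).
Definition lopZ (c : K) S : Lop := c \*: (S : {linear X -> X}).
Definition lop1 : Lop := idfun.
Definition lopM S T : Lop := (S : {linear X -> X}) \o (T : {linear X -> X}).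
Local Notation ext := (@linear_eq K X X).
Lemma lopDA : associative lopD.
Proof. by move=> f g h; apply: ext => x /=; rewrite addrA. Qed.
Lemma lopDC : commutative lopD.
Proof. by move=> f g; apply: ext => x /=; rewrite addrC. Qed.
Lemma lop0D : left_id lop0 lopD.
Proof. by move=> f; apply: ext => x /=; rewrite add0r. Qed.
Lemma lopND : left_inverse lop0 lopN lopD.
Proof. by move=> f; apply: ext => x /=; rewrite addNr. Qed.
HB.instance Definition _ := GRing.isZmodule.Build Lop lopDA lopDC lop0D lopND.

Lemma lopMA : associative lopM.
Proof. by move=> f g h; apply: ext. Qed.
Lemma lop1M : left_id lop1 lopM.
Proof. by move=> f; apply: ext. Qed.
Lemma lopM1 : right_id lop1 lopM.
Proof. by move=> f; apply: ext. Qed.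
Lemma lopMDl : left_distributive lopM +%R.
Proof. by move=> f g h; apply: ext. Qed.
Lemma lopMDr : right_distributive lopM +%R.
Proof. by move=> f g h; apply: ext => x /=; rewrite linearD. Qed.
Lemma lop1_neq0 : lop1 != 0.
Proof.
apply/eqP => /(congr1 (fun S : Lop => S xi)) /= /eqP.
by rewrite (negbTE (pvec_neq0 X)).
Qed.
HB.instance Definition _ :=
  GRing.Zmodule_isNzRing.Build Lop lopMA lop1M lopM1 lopMDl lopMDr lop1_neq0.

Lemma lopZA a b S : lopZ a (lopZ b S) = lopZ (a * b) S.
Proof. by apply: ext => x /=; rewrite scalerA. Qed.
Lemma lop1Z : left_id 1 lopZ.
Proof. by move=> f; apply: ext => x /=; rewrite scale1r. Qed.
Lemma lopZDr : right_distributive lopZ +%R.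
Proof. by move=> c f g; apply: ext => x /=; rewrite scalerDr. Qed.
Lemma lopZDl S : {morph lopZ^~ S : a b / a + b}.
Proof. by move=> a b; apply: ext => x /=; rewrite scalerDl. Qed.
HB.instance Definition _ :=
  GRing.Zmodule_isLmodule.Build K Lop lopZA lop1Z lopZDr lopZDl.
Lemma lopZAl c S T : c *: (S * T) = (c *: S) * T.
Proof. by apply: ext. Qed.
Lemma lopZAr c S T : c *: (S * T) = S * (c *: T).
Proof. by apply: ext => x /=; rewrite linearZ. Qed.
HB.instance Definition _ := GRing.Lmodule_isLalgebra.Build K Lop lopZAl.
HB.instance Definition _ := GRing.Lalgebra_isAlgebra.Build K Lop lopZAr.

Definition pstate (T : Lop) : K := pcoef ((T : {linear X -> X}) xi).

Lemma pstateE T : pproj X ((T : {linear X -> X}) xi) = pstate T *: xi.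
Proof. exact: pcoefE. Qed.
End PointedSpace.

Section FreeProduct.
Variables (K : fieldType) (X : bool -> pspace K).
Implicit Types (d : bool) (w : seq bool).

(* The tensor product of the complements of the X d over the letters d of w; it
   is right-nested and ends with a factor K, so the empty word gives the line of
   the state-vector of the free product. *)
Fixpoint word_space w : lmodType K :=
  if w is d :: w' then tensor (pker (X d)) (word_space w') else K^o.

Definition alternating w := sorted (fun d d' => d != d') w.
(* Alternating words whose first (resp. last) letter is not d; the default
   ~~ d lets the empty word in. *)
Definition lword d w := alternating w && (head (~~ d) w != d).
Definition rword d w := alternating w && (last (~~ d) w != d).

Definition fprod_car : lmodType K := dsum alternating word_space.
Definition lspace d : lmodType K := dsum (lword d) word_space.
Definition rspace d : lmodType K := dsum (rword d) word_space.

Definition fprod_vec : fprod_car := dinj alternating word_space [::] (1 : K^o).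

Definition fprod_proj : {linear fprod_car -> fprod_car} :=
  dinj alternating word_space [::] \o dpr alternating word_space [::].

Lemma fprod_vec_neq0 : fprod_vec != 0.
Proof.
apply/eqP => /(congr1 (fun f : fprod_car => f [::] : K^o)).
by rewrite dinj_id //; apply/eqP; exact: oner_neq0.
Qed.

Lemma fprod_proj_vec : fprod_proj fprod_vec = fprod_vec.
Proof. by congr (dinj _ _ _ _); rewrite -[LHS]/(fprod_vec [::]) dinj_id. Qed.

Lemma fprod_proj_line x : exists c, fprod_proj x = c *: fprod_vec.
Proof.
by exists (x [::] : K^o); rewrite -linearZ /= -[_ *: _]/(_ * 1) mulr1.
Qed.

Definition fprod : pspace K :=
  PSpace fprod_vec_neq0 fprod_proj_vec fprod_proj_line.

(* appending the vector x on the right of a tensor: t |-> t (x) x *)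
Fixpoint tcat d (x : pker (X d)) w :
    {linear word_space w -> word_space (rcons w d)} :=
  match w return {linear word_space w -> word_space (rcons w d)} with
  | [::] => mklin (@tens_linearr K (pker (X d)) K^o x)
  | d' :: w' => tmap idfun (tcat x w')
  end.

Lemma tcat_cons d (x : pker (X d)) d' w y t :
  tcat x (d' :: w) (tens y t) = tens y (tcat x w t).
Proof. exact: tmapE. Qed.

Lemma tcat_linear d w (t : word_space w) :
  linear ((fun x => tcat x w t) : pker (X d) -> _).
Proof.
elim: w t => [|d' w IH] t c x y; first exact: tens_linearl.
pose f : {linear word_space (d' :: w) -> word_space (rcons (d' :: w) d)} :=
  c \*: tcat x (d' :: w) \+ tcat y (d' :: w).
rewrite -[LHS]/(tcat (c *: x + y) (d' :: w) t) -[RHS]/(f t).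
apply: tensor_ext => u v.
rewrite -[RHS]/(c *: tcat x (d' :: w) (tens u v) + tcat y (d' :: w) (tens u v)).
by rewrite !tcat_cons IH tens_linearr.
Qed.

Definition tensr (U V : lmodType K) (x : U) : {linear V -> tensor U V} :=
  mklin (@tens_linearr K U V x).
Definition tensl (U V : lmodType K) (y : V) : {linear U -> tensor U V} :=
  mklin (@tens_linearl K U V y).

Section TcatInverse.
Variables (A B C : lmodType K).
Let asr a (b : B) := fun c : C => tens (tens (a : A) b) c.

Lemma assoc_inner_linearl a c : linear (fun b => asr a b c).
Proof. by move=> k x y; rewrite /asr tens_linearr tens_linearl. Qed.
Lemma assoc_inner_linearr a b : linear (asr a b).
Proof. exact: tens_linearr. Qed.
Definition assoc_inner a : {linear tensor B C -> tensor (tensor A B) C} :=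
  tlift (assoc_inner_linearl a) (assoc_inner_linearr a).

Lemma assoc_linearl q : linear (fun a => assoc_inner a q).
Proof.
move=> k a a'.
pose f : {linear tensor B C -> tensor (tensor A B) C} :=
  k \*: assoc_inner a \+ assoc_inner a'.
rewrite -[RHS]/(f q); move: q; apply: tensor_ext => b c.
rewrite -[RHS]/(k *: assoc_inner a (tens b c) + assoc_inner a' (tens b c)).
by rewrite /assoc_inner !tliftE /asr !tens_linearl.
Qed.

Lemma assoc_linearr a : linear (assoc_inner a). Proof. exact: linearP. Qed.

Definition tassoc : {linear tensor A (tensor B C) -> tensor (tensor A B) C} :=
  tlift assoc_linearl assoc_linearr.

Lemma tassocE a b c : tassoc (tens a (tens b c)) = tens (tens a b) c.
Proof. by rewrite /tassoc tliftE /assoc_inner tliftE. Qed.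
End TcatInverse.

Lemma tcat_inv d w :
  exists U : {linear word_space (rcons w d) -> tensor (word_space w) (pker (X d))},
    forall x t, U (tcat x w t) = tens t x.
Proof.
elim: w => [|d' w [U UE]].
  have linl c : linear (fun x : pker (X d) => tens (c : K^o) x).
    exact: tens_linearr.
  have linr (x : pker (X d)) : linear (fun c : K^o => tens c x).
    exact: tens_linearl.
  by exists (tlift linl linr) => x t; rewrite tliftE.
exists (@tassoc _ _ _ \o tmap idfun U) => x t.
pose f : {linear word_space (d' :: w) -> _} :=
  @tassoc _ _ _ \o (tmap idfun U \o tcat x (d' :: w)).
rewrite -[LHS]/(f t) -[RHS]/(tensl _ x t); move: t; apply: tensor_ext => y t.
rewrite -[LHS]/(tassoc _ _ _ (tmap idfun U (tcat x (d' :: w) (tens y t)))).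
by rewrite tcat_cons tmapE UE tassocE.
Qed.

Lemma tcat_ext d w (Z : lmodType K) (f g : {linear word_space (rcons w d) -> Z}) :
  (forall x t, f (tcat x w t) = g (tcat x w t)) -> f =1 g.
Proof.
elim: w f g => [|d' w IH] f g fg; apply: tensor_ext => y t; first exact: fg.
pose h (f : {linear word_space (rcons (d' :: w) d) -> Z}) :
  {linear word_space (rcons w d) -> Z} := f \o tensr _ y.
rewrite -[LHS]/(h f t) -[RHS]/(h g t); move: t; apply: IH => x t.
by have := fg x (tens y t); rewrite tcat_cons.
Qed.

Section Natural.
Variable d : bool.

(* The natural identification on x (x) t, with t in the summand of the word w
   and x = a xi + x0, x0 in the complement: a xi (x) t is sent to a t, and
   x0 (x) t to the concatenation, in the summand of d :: w. *)
Definition lnat_word_fun (x : X d) w (t : word_space w) : fprod :=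
  pcoef (X d) x *: dinj alternating word_space w t
  + dinj alternating word_space (d :: w) (tens (pcomp (X d) x) t).

Lemma lnat_word_linear x w : linear (@lnat_word_fun x w).
Proof.
move=> c t t'; rewrite /lnat_word_fun tens_linearr !linearP /= ?scalerDr.
by rewrite !scalerA mulrC addrACA.
Qed.

Definition lnat_word x w : {linear word_space w -> fprod} :=
  mklin (@lnat_word_linear x w).

(* the mirror image: t (x) x is sent to a t plus t followed by x0 *)
Definition rnat_word_fun (x : X d) w (t : word_space w) : fprod :=
  pcoef (X d) x *: dinj alternating word_space w t
  + dinj alternating word_space (rcons w d) (tcat (pcomp (X d) x) w t).

Lemma rnat_word_linear x w : linear (@rnat_word_fun x w).
Proof.
move=> c t t'; rewrite /rnat_word_fun !linearP /= ?scalerDr.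
by rewrite !scalerA mulrC addrACA.
Qed.

Definition rnat_word x w : {linear word_space w -> fprod} :=
  mklin (@rnat_word_linear x w).

Lemma lnat_linearl (y : lspace d) : linear (fun x => dlift (lword d) (lnat_word x) y).
Proof.
move=> c x x'.
pose f : {linear lspace d -> fprod} :=
  c \*: dlift (lword d) (lnat_word x) \+ dlift (lword d) (lnat_word x').
rewrite -[RHS]/(f y); move: y; apply: dsum_linear_ext => w t Pw.
rewrite dliftE // -[RHS]/(c *: dlift (lword d) (lnat_word x) (dinj _ _ w t)
  + dlift (lword d) (lnat_word x') (dinj _ _ w t)) !dliftE //.
rewrite /= /lnat_word_fun linearP scalerDl -scalerA linearP tens_linearl linearP.
by rewrite scalerDr addrACA.
Qed.

Lemma lnat_linearr (x : X d) : linear (dlift (lword d) (lnat_word x) : lspace d -> _).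
Proof. exact: linearP. Qed.

Lemma rnat_linearl (x : X d) : linear (dlift (rword d) (rnat_word x) : rspace d -> _).
Proof. exact: linearP. Qed.

Lemma rnat_linearr (y : rspace d) : linear (fun x => dlift (rword d) (rnat_word x) y).
Proof.
move=> c x x'.
pose f : {linear rspace d -> fprod} :=
  c \*: dlift (rword d) (rnat_word x) \+ dlift (rword d) (rnat_word x').
rewrite -[RHS]/(f y); move: y; apply: dsum_linear_ext => w t Pw.
rewrite dliftE // -[RHS]/(c *: dlift (rword d) (rnat_word x) (dinj _ _ w t)
  + dlift (rword d) (rnat_word x') (dinj _ _ w t)) !dliftE //.
rewrite /= /rnat_word_fun linearP scalerDl -scalerA linearP tcat_linear linearP.
by rewrite scalerDr addrACA.
Qed.

Definition Vmap : {linear tensor (X d) (lspace d) -> fprod} :=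
  tlift lnat_linearl lnat_linearr.

Definition Wmap : {linear tensor (rspace d) (X d) -> fprod} :=
  tlift rnat_linearl rnat_linearr.

Lemma VmapE x w t : lword d w -> Vmap (tens x (dinj (lword d) word_space w t)) =
  pcoef (X d) x *: dinj alternating word_space w t
  + dinj alternating word_space (d :: w) (tens (pcomp (X d) x) t).
Proof. by move=> Pw; rewrite tliftE; exact: dliftE. Qed.

Lemma WmapE x w t : rword d w -> Wmap (tens (dinj (rword d) word_space w t) x) =
  pcoef (X d) x *: dinj alternating word_space w t
  + dinj alternating word_space (rcons w d) (tcat (pcomp (X d) x) w t).
Proof. by move=> Pw; rewrite tliftE; exact: dliftE. Qed.

Lemma lword_alt w : lword d w -> alternating w. Proof. by case/andP. Qed.
Lemma rword_alt w : rword d w -> alternating w. Proof. by case/andP. Qed.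

Lemma alt_cons w : alternating (d :: w) = lword d w.
Proof.
by case: w => [|d' w]; rewrite /lword /alternating //=; [case: d|rewrite andbC eq_sym].
Qed.

Lemma alt_rcons w : alternating (rcons w d) = rword d w.
Proof.
case: w => [|d' w]; rewrite /rword /alternating /=; first by case: d.
by rewrite rcons_path.
Qed.

Local Notation linj := (dinj (lword d) word_space).
Local Notation rinj := (dinj (rword d) word_space).

Lemma Vinv_word_subproof w :
  exists G : {linear word_space w -> tensor (X d) (lspace d)},
    (lword d w -> forall t, G t = tens (pvec (X d)) (linj w t)) /\
    (forall w' (e : d :: w' = w), lword d w' -> forall x t,
      G (ecast i (word_space i) e (tens x t)) = tens (val x) (linj w' t)).
Proof.
have [lw|nlw] := boolP (lword d w).
  have lin : linear (fun t => tens (pvec (X d)) (linj w t)).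
    by move=> c x y; rewrite linearP tens_linearr.
  exists (mklin lin); split=> // w' e.
  suff: lword d w = false by rewrite lw.
  by rewrite -e /lword /= eqxx andbF.
case: w nlw => [|d' w] nlw; first by exists \0; split.
have [ed|nd] := eqVneq d d'; last first.
  exists \0; split=> // w' e.
  by case: (e) => ed; rewrite ed eqxx in nd.
case: d' / ed nlw => nlw.
have linl (t : word_space w) : linear (fun x : pker (X d) => tens (val x) (linj w t)).
  by move=> c x y; rewrite linearP tens_linearl.
have linr (x : pker (X d)) : linear (fun t => tens (val x) (linj w t)).
  by move=> c t t'; rewrite linearP tens_linearr.
exists (tlift linl linr); split=> // w' e lw x t.
case: (e) => ew; move: e t lw; rewrite ew => e t lw.
by rewrite (eq_axiomK e) tliftE.
Qed.

Definition Vinv_word w := projT1 (cid (Vinv_word_subproof w)).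

Definition Vinv : {linear fprod -> tensor (X d) (lspace d)} :=
  dlift alternating Vinv_word.

Lemma Vinv_lword w t : lword d w ->
  Vinv (dinj alternating word_space w t) = tens (pvec (X d)) (linj w t).
Proof.
move=> lw; rewrite /Vinv dliftE ?(lword_alt lw) //.
exact: (projT2 (cid (Vinv_word_subproof w))).1.
Qed.

Lemma Vinv_cons w x t : lword d w ->
  Vinv (dinj alternating word_space (d :: w) (tens x t)) = tens (val x) (linj w t).
Proof.
move=> lw; rewrite /Vinv dliftE ?alt_cons //.
exact: ((projT2 (cid (Vinv_word_subproof (d :: w)))).2 _ erefl).
Qed.

Lemma tens_pdecomp (V : lmodType K) (x : X d) (v : V) :
  tens x v = pcoef (X d) x *: tens (pvec (X d)) v + tens (val (pcomp (X d) x)) v.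
Proof. by rewrite -tens_linearl -pdecomp. Qed.

Lemma VmapK : cancel Vmap Vinv.
Proof.
pose f : {linear tensor (X d) (lspace d) -> _} := Vinv \o Vmap.
rewrite -[cancel _ _]/(f =1 idfun); apply: tensor_ext => x y.
pose g : {linear lspace d -> _} := f \o tensr _ x.
rewrite -[LHS]/(g y) -[RHS]/(tensr _ x y); move: y.
apply: dsum_linear_ext => w t lw.
rewrite -[LHS]/(Vinv (Vmap (tens x (linj w t)))) -[RHS]/(tens x (linj w t)).
rewrite VmapE // linearP.
by rewrite [RHS]tens_pdecomp Vinv_lword // Vinv_cons.
Qed.

Lemma VinvK : cancel Vinv Vmap.
Proof.
pose f : {linear fprod -> fprod} := Vmap \o Vinv.
rewrite -[cancel _ _]/(f =1 idfun); apply: dsum_linear_ext => w t aw.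
rewrite -[LHS]/(Vmap (Vinv _)) -[RHS]/(dinj alternating word_space w t).
have [lw|nlw] := boolP (lword d w).
  rewrite Vinv_lword // VmapE // pcoef_vec scale1r pcomp_vec.
  by rewrite -[tens 0 t]/(tensl _ t 0) !linear0 addr0.
case: w t aw nlw => [|d' w] t aw nlw; first by case/negP: nlw; rewrite /lword; case: (d).
have ed : d' = d by move: nlw; rewrite /lword aw /= negbK => /eqP.
move: ed t aw {nlw} => -> t; rewrite alt_cons => lw.
pose g : {linear word_space (d :: w) -> fprod} := 
  Vmap \o (Vinv \o dinj alternating word_space (d :: w)).
rewrite -[LHS]/(g t); move: t; apply: tensor_ext => x t.
rewrite -[LHS]/(Vmap (Vinv _)) Vinv_cons // VmapE //.
by rewrite pcoef_ker scale0r add0r pcomp_ker.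
Qed.

Lemma Vmap_bij : bijective Vmap.
Proof. by exists Vinv; [exact: VmapK|exact: VinvK]. Qed.

Lemma Winv_word_subproof w :
  exists G : {linear word_space w -> tensor (rspace d) (X d)},
    (rword d w -> forall t, G t = tens (rinj w t) (pvec (X d))) /\
    (forall w' (e : rcons w' d = w), rword d w' -> forall x t,
      G (ecast i (word_space i) e (tcat x w' t)) = tens (rinj w' t) (val x)).
Proof.
have [rw|nrw] := boolP (rword d w).
  have lin : linear (fun t => tens (rinj w t) (pvec (X d))).
    by move=> c x y; rewrite linearP tens_linearl.
  exists (mklin lin); split=> // w' e.
  suff: rword d w = false by rewrite rw.
  by rewrite -e /rword last_rcons eqxx andbF.
case/lastP: w nrw => [|w d'] nrw; first by exists \0; split=> // -[].
have [ed|nd] := eqVneq d d'; last first.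
  exists \0; split=> // w' e.
  by case: (rcons_inj e) => _ ed; rewrite ed eqxx in nd.
case: d' / ed nrw => nrw.
have linl (x : pker (X d)) : linear (fun t => tens (rinj w t) (val x)).
  by move=> c t t'; rewrite linearP tens_linearl.
have linr (t : word_space w) : linear (fun x : pker (X d) => tens (rinj w t) (val x)).
  by move=> c x y; rewrite linearP tens_linearr.
have [U UE] := tcat_inv d w.
exists (tlift linl linr \o U); split=> // w' e rw x t.
case: (rcons_inj e) => ew; move: e t rw; rewrite ew => e t rw.
rewrite (eq_axiomK e) -[LHS]/(tlift linl linr (U (tcat x w t))).
by rewrite UE tliftE.
Qed.

Definition Winv_word w := projT1 (cid (Winv_word_subproof w)).

Definition Winv : {linear fprod -> tensor (rspace d) (X d)} :=
  dlift alternating Winv_word.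

Lemma Winv_rword w t : rword d w ->
  Winv (dinj alternating word_space w t) = tens (rinj w t) (pvec (X d)).
Proof.
move=> rw; rewrite /Winv dliftE ?(rword_alt rw) //.
exact: (projT2 (cid (Winv_word_subproof w))).1.
Qed.

Lemma Winv_rcons w x t : rword d w ->
  Winv (dinj alternating word_space (rcons w d) (tcat x w t)) =
  tens (rinj w t) (val x).
Proof.
move=> rw; rewrite /Winv dliftE ?alt_rcons //.
exact: ((projT2 (cid (Winv_word_subproof (rcons w d)))).2 _ erefl).
Qed.

Lemma tens_pdecompr (V : lmodType K) (v : V) (x : X d) :
  tens v x = pcoef (X d) x *: tens v (pvec (X d)) + tens v (val (pcomp (X d) x)).
Proof. by rewrite -tens_linearr -pdecomp. Qed.

Lemma WmapK : cancel Wmap Winv.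
Proof.
pose f : {linear tensor (rspace d) (X d) -> _} := Winv \o Wmap.
rewrite -[cancel _ _]/(f =1 idfun); apply: tensor_ext => y x.
pose g : {linear rspace d -> _} := f \o tensl _ x.
rewrite -[LHS]/(g y) -[RHS]/(tensl _ x y); move: y.
apply: dsum_linear_ext => w t rw.
rewrite -[LHS]/(Winv (Wmap (tens (rinj w t) x))) -[RHS]/(tens (rinj w t) x).
rewrite WmapE // linearP.
by rewrite [RHS]tens_pdecompr Winv_rword // Winv_rcons.
Qed.

Lemma WinvK : cancel Winv Wmap.
Proof.
pose f : {linear fprod -> fprod} := Wmap \o Winv.
rewrite -[cancel _ _]/(f =1 idfun); apply: dsum_linear_ext => w t aw.
rewrite -[LHS]/(Wmap (Winv _)) -[RHS]/(dinj alternating word_space w t).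
have [rw|nrw] := boolP (rword d w).
  rewrite Winv_rword // WmapE // pcoef_vec scale1r pcomp_vec.
  have -> : tcat (0 : pker (X d)) w t = 0.
    exact: (linear0 (mklin (@tcat_linear d w t))).
  by rewrite linear0 addr0.
case/lastP: w t aw nrw => [|w d'] t aw nrw.
  by case/negP: nrw; rewrite /rword; case: (d).
have ed : d' = d by move: nrw; rewrite /rword aw last_rcons negbK => /eqP.
move: ed t aw {nrw} => -> t; rewrite alt_rcons => rw.
pose g : {linear word_space (rcons w d) -> fprod} :=
  Wmap \o (Winv \o dinj alternating word_space (rcons w d)).
rewrite -[LHS]/(g t); move: t; apply: tcat_ext => x t.
rewrite -[LHS]/(Wmap (Winv _)) Winv_rcons // WmapE //.
by rewrite pcoef_ker scale0r add0r pcomp_ker.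
Qed.

Lemma Wmap_bij : bijective Wmap.
Proof. by exists Winv; [exact: WmapK|exact: WinvK]. Qed.

Definition lrep (T : Lop (X d)) : Lop fprod :=
  Vmap \o (tmap (T : {linear X d -> X d}) idfun \o linv Vmap_bij).

Definition rrep (T : Lop (X d)) : Lop fprod :=
  Wmap \o (tmap idfun (T : {linear X d -> X d}) \o linv Wmap_bij).

Lemma lrepE T q : (lrep T : {linear fprod -> fprod}) (Vmap q) =
  Vmap (tmap (T : {linear X d -> X d}) idfun q).
Proof. by rewrite /lrep /= linvK. Qed.

Lemma rrepE T q : (rrep T : {linear fprod -> fprod}) (Wmap q) =
  Wmap (tmap idfun (T : {linear X d -> X d}) q).
Proof. by rewrite /rrep /= linvK. Qed.
End Natural.
End FreeProduct.

Record ncspace (K : fieldType) := NCSpace {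
  nc_alg :> algType K;
  nc_state : {scalar nc_alg};
  nc_state1 : nc_state 1 = 1 }.

Section BiNonCrossing.
Variables (n : nat) (chi : 'I_n -> bool).

(* the list s_chi(1), ..., s_chi(n): the left indices in increasing order, then
   the right ones in decreasing order *)
Definition schi_seq : seq 'I_n := enum [pred i | chi i] ++ rev (enum [pred i | ~~ chi i]).

Lemma schi_size : size schi_seq = n.
Proof.
rewrite size_cat size_rev -!cardE -[RHS](card_ord n) -(cardC [pred i | chi i]).
by congr addn; apply: eq_card.
Qed.

Lemma schi_uniq : uniq schi_seq.
Proof.
rewrite cat_uniq rev_uniq !enum_uniq andbT /=; apply/hasPn => i.
by rewrite mem_rev !mem_enum !inE => /negbTE->.
Qed.

Definition schi_fun (k : 'I_n) : 'I_n := nth k schi_seq k.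

Lemma schi_inj : injective schi_fun.
Proof.
move=> k k'; rewrite /schi_fun (set_nth_default k') ?schi_size // => /eqP.
by rewrite nth_uniq ?schi_size ?schi_uniq // => /eqP/ord_inj.
Qed.

Definition schi : {perm 'I_n} := perm schi_inj.

Definition noncrossing (pi : {set {set 'I_n}}) : bool :=
  [forall V in pi, forall W in pi, (V != W) ==>
    [forall a : 'I_n, forall b : 'I_n, forall c : 'I_n, forall d : 'I_n,
      ~~ [&& a < b, b < c, c < d, a \in V, b \in W, c \in V & d \in W]%N]].

Definition BNC : {set {set {set 'I_n}}} :=
  [set pi | partition pi [set: 'I_n]
            && noncrossing [set (schi^-1)%g @: (V : {set 'I_n}) | V in pi]].

Lemma BNC_setT : (0 < n)%N -> [set [set: 'I_n]] \in BNC.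
Proof.
move=> n0; rewrite inE; apply/andP; split.
  rewrite /partition cover1 eqxx trivIset1 inE /=.
  by apply/eqP => /setP/(_ (Ordinal n0)); rewrite !inE.
rewrite imset_set1; apply/forall_inP => V; rewrite inE => /eqP->.
by apply/forall_inP => W; rewrite inE => /eqP->; rewrite eqxx.
Qed.
End BiNonCrossing.

(* the restriction f|V, V being listed increasingly by [enum_val] *)
Definition restr T n (V : {set 'I_n}) (f : 'I_n -> T) : 'I_#|V| -> T :=
  fun t => f (enum_val t).
Arguments restr {T n} V f _.

Section Cumulants.
Variables (K : fieldType) (A : ncspace K).

(* The moment-cumulant formula solved for the term of the one-block partition.
   The first argument is fuel: the blocks of the other partitions have fewer
   than n elements. Theorems [moment_cumulant], [kappa_unique] and
   [kappa_multilinear] give the usual characterization. *)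
Fixpoint kappa_rec (m : nat) n (chi : 'I_n -> bool) (a : 'I_n -> A) : K :=
  if m is m'.+1 then
    nc_state A (\prod_(i < n) a i)
    - \sum_(pi in BNC chi | pi != [set [set: 'I_n]])
        \prod_(V in pi) kappa_rec m' (restr V chi) (restr V a)
  else 0.

Definition kappa n (chi : 'I_n -> bool) (a : 'I_n -> A) : K :=
  kappa_rec n chi a.

Lemma block_lt n (chi : 'I_n -> bool) pi V :
  pi \in BNC chi -> pi != [set [set: 'I_n]] -> V \in pi -> (0 < #|V| < n)%N.
Proof.
rewrite inE => /andP[pP _] npi Vpi; apply/andP; split.
  rewrite card_gt0; apply: contraTneq Vpi => ->.
  by case/and3P: pP.
rewrite -[X in (_ < X)%N]card_ord -cardsT; apply: proper_card.
rewrite properT; apply: contraNneq npi => VT.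
apply/eqP/setP => W; rewrite inE; apply/idP/eqP => [Wpi|->]; last by rewrite -VT.
apply/eqP; apply: contraT => nWT.
case/and3P: pP => _ /trivIsetP/(_ _ _ Wpi Vpi) + s0.
rewrite VT => /(_ nWT); rewrite -setI_eq0 setIT => /eqP W0.
by rewrite W0 in Wpi; rewrite Wpi in s0.
Qed.

Lemma kappa_recE m n (chi : 'I_n -> bool) (a : 'I_n -> A) :
  (0 < n <= m)%N -> kappa_rec m chi a = kappa chi a.
Proof.
have [N] := ubnP n; elim: N m n chi a => // N IH [|m] [|n] chi a //= nN nm.
rewrite /kappa /=; congr (_ - _); apply: eq_bigr => pi /andP[piB npi].
apply: eq_bigr => V Vpi; have /andP[V0 Vn] := block_lt piB npi Vpi.
have VN : (#|V| < N)%N by exact: leq_trans Vn _.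
rewrite (IH m) ?(IH n) // ?V0 //= -ltnS //; exact: leq_trans Vn _.
Qed.

Lemma restr_setT (F : forall n, ('I_n -> bool) -> ('I_n -> A) -> K)
    n (chi : 'I_n -> bool) (a : 'I_n -> A) :
  F _ (restr [set: 'I_n] chi) (restr [set: 'I_n] a) = F _ chi a.
Proof.
have e : #|[set: 'I_n]| = n by rewrite cardsT card_ord.
have ev (t : 'I_#|[set: 'I_n]|) : enum_val t = cast_ord e t.
  apply: val_inj; rewrite (enum_val_nth (cast_ord e t)) /=.
  rewrite enum_setT -enumT nth_enum_ord //.
  by rewrite -[X in (_ < X)%N]e.
have -> : restr [set: 'I_n] chi = chi \o cast_ord e.
  by apply: funext => t; rewrite /restr ev.
have -> : restr [set: 'I_n] a = a \o cast_ord e.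
  by apply: funext => t; rewrite /restr ev.
case: _ / (esym e) (e) => e'.
by congr F; apply: funext => t /=; rewrite cast_ord_id.
Qed.

Theorem moment_cumulant n (chi : 'I_n -> bool) (a : 'I_n -> A) : (0 < n)%N ->
  nc_state A (\prod_(i < n) a i) =
  \sum_(pi in BNC chi) \prod_(V in pi) kappa (restr V chi) (restr V a).
Proof.
move=> n0; rewrite (bigD1 [set [set: 'I_n]]) ?BNC_setT //= big_set1.
rewrite (restr_setT kappa) {1}/kappa; case: n n0 chi a => // n _ chi a /=.
rewrite -[LHS](subrK (\sum_(pi in BNC chi | pi != [set [set: 'I_n.+1]])
        \prod_(V in pi) kappa_rec n (restr V chi) (restr V a))).
congr (_ + _); apply: eq_bigr => pi /andP[piB npi].
apply: eq_bigr => V Vpi; have /andP[V0 Vn] := block_lt piB npi Vpi.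
by rewrite kappa_recE // V0 -ltnS.
Qed.

Theorem kappa_unique (k : forall n, ('I_n -> bool) -> ('I_n -> A) -> K) :
  (forall n (chi : 'I_n -> bool) (a : 'I_n -> A), (0 < n)%N ->
     nc_state A (\prod_(i < n) a i) =
     \sum_(pi in BNC chi) \prod_(V in pi) k _ (restr V chi) (restr V a)) ->
  forall n (chi : 'I_n -> bool) (a : 'I_n -> A), (0 < n)%N ->
    k n chi a = kappa chi a.
Proof.
move=> kP n; have [N] := ubnP n; elim: N n => // N IH n nN chi a n0.
have := kP n chi a n0; rewrite (moment_cumulant chi a n0).
rewrite (bigD1 [set [set: 'I_n]]) ?BNC_setT //= big_set1 (restr_setT kappa).
rewrite [RHS](bigD1 [set [set: 'I_n]]) ?BNC_setT //= big_set1 (restr_setT k).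
under eq_bigr => pi /andP[piB npi].
  under eq_bigr => V Vpi.
    have /andP[V0 Vn] := block_lt piB npi Vpi.
    rewrite -IH ?V0 //; last exact: leq_trans Vn _.
    over.
  over.
by move=> /addIr->.
Qed.
Lemma prod_linear (T : eqType) (r : seq T) (i0 : T) (c : K) (a b e : T -> A) :
  uniq r -> i0 \in r -> (forall i, i != i0 -> a i = e i /\ b i = e i) ->
  e i0 = c *: a i0 + b i0 ->
  \prod_(i <- r) e i = c *: \prod_(i <- r) a i + \prod_(i <- r) b i.
Proof.
move=> + + ab ei0; elim: r => // i r IH /andP[ir ur]; rewrite inE !big_cons.
have [ii _|nii /= i0r] := eqVneq i0 i; last first.
  have [-> ->] : a i = e i /\ b i = e i by apply: ab; rewrite eq_sym.
  by rewrite IH // mulrDr scalerAr.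
rewrite -ii in ir *.
have off j : j \in r -> a j = e j /\ b j = e j.
  by move=> jr; apply: ab; apply: contraNneq ir => <-.
have -> : \prod_(j <- r) a j = \prod_(j <- r) e j.
  by apply: eq_big_seq => j /off[].
have -> : \prod_(j <- r) b j = \prod_(j <- r) e j.
  by apply: eq_big_seq => j /off[].
by rewrite ei0 mulrDl scalerAl.
Qed.

Theorem kappa_multilinear n (chi : 'I_n -> bool) (i0 : 'I_n) (c : K)
    (a b e : 'I_n -> A) :
  (forall i, i != i0 -> a i = e i /\ b i = e i) -> e i0 = c *: a i0 + b i0 ->
  kappa chi e = c * kappa chi a + kappa chi b.
Proof.
have [N] := ubnP n; elim: N n chi i0 a b e => // N IH n chi i0 a b e nN ab ei0.
have n0 : (0 < n)%N by apply: leq_ltn_trans (ltn_ord i0).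
have mE f : kappa chi f = nc_state A (\prod_(i < n) f i)
    - \sum_(pi in BNC chi | pi != [set [set: 'I_n]])
        \prod_(V in pi) kappa (restr V chi) (restr V f).
  rewrite (moment_cumulant chi f n0) (bigD1 [set [set: 'I_n]]) ?BNC_setT //=.
  by rewrite big_set1 (restr_setT kappa) addrK.
rewrite !mE (@prod_linear _ _ i0 c a b e) ?index_enum_uniq ?mem_index_enum //.
rewrite linearP /= mulrBr addrACA -opprD; congr (_ - _).
rewrite mulr_sumr -big_split /=; apply: eq_bigr => pi /andP[piB npi].
have pP : partition pi [set: 'I_n] by move: piB; rewrite inE => /andP[].
have [V Vpi i0V] : exists2 V, V \in pi & i0 \in V.
  have : i0 \in cover pi by rewrite (cover_partition pP) inE.
  by case/bigcupP => V; exists V.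
have off W : W \in pi -> W != V -> i0 \notin W.
  move=> Wpi nWV; apply: contraNN nWV => i0W.
  have /trivIsetP/(_ _ _ Wpi Vpi) tI : trivIset pi by case/and3P: pP.
  apply: contraT => /tI/pred0P/(_ i0); by rewrite /= i0W i0V.
have same f : (forall i, i != i0 -> f i = e i) ->
    \prod_(W in pi | W != V) kappa (restr W chi) (restr W f) =
    \prod_(W in pi | W != V) kappa (restr W chi) (restr W e).
  move=> fe; apply: eq_bigr => W /andP[Wpi nWV]; congr kappa.
  apply: funext => t; apply: fe; apply: contraNneq (off _ Wpi nWV) => <-.
  exact: enum_valP.
rewrite !(bigD1 V Vpi) /= (same a) ?(same b); last 2 first.
- by move=> i /ab[].
- by move=> i /ab[].
rewrite mulrA -mulrDl; congr (_ * _).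
have /andP[_ Vn] := block_lt piB npi Vpi.
apply: (IH _ _ (enum_rank_in i0V i0)); first exact: leq_trans Vn _.
  move=> t nt; apply: ab; apply: contraNneq nt => ti.
  by apply/eqP/enum_val_inj; rewrite ti enum_rankK_in.
by rewrite /restr enum_rankK_in.
Qed.
End Cumulants.

Section BiFree.
Variables (K : fieldType) (A : ncspace K) (I J : choiceType).

(* indices in I are the left ones, indices in J the right ones *)
Definition two_faced := I + J -> A.

Definition fam (z' z'' : two_faced) (d : bool) : two_faced := if d then z'' else z'.

(* non-commutative polynomials: the monoid algebra of the free monoid on T *)
Definition ncpoly (T : choiceType) := {malg K[{fmonom T}]}.
Definition ncvar (T : choiceType) (t : T) : ncpoly T := << fmu t >>.

Definition rep_family (X : bool -> pspace K)
    (l : forall d, {lrmorphism ncpoly I -> Lop (X d)})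
    (r : forall d, {lrmorphism ncpoly J -> Lop (X d)})
    (d : bool) (k : I + J) : Lop (fprod X) :=
  match k with
  | inl i => lrep (l d (ncvar i))
  | inr j => rrep (r d (ncvar j))
  end.

Definition bi_free (z' z'' : two_faced) : Prop :=
  exists (X : bool -> pspace K)
         (l : forall d, {lrmorphism ncpoly I -> Lop (X d)})
         (r : forall d, {lrmorphism ncpoly J -> Lop (X d)}),
  forall s : seq (bool * (I + J)),
    pstate (\prod_(k <- s) rep_family l r k.1 k.2)
    = nc_state A (\prod_(k <- s) fam z' z'' k.1 k.2).

Definition comb_bi_free (z' z'' : two_faced) : Prop :=
  forall n (alpha : 'I_n -> I + J) (chi : 'I_n -> bool) (eps : 'I_n -> bool),
    (0 < n)%N -> (forall t, is_inl (alpha t) = chi t) ->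
    ~ (exists d, forall t, eps t = d) ->
    kappa chi (fun t => fam z' z'' (eps t) (alpha t)) = 0.
End BiFree.

(* Main.v *)
From Pilot Require Import Defs.
From mathcomp Require Import all_boot all_order all_algebra.
From mathcomp Require Import reals complex.
From HB Require Import structures.
From mathcomp Require Import perm boolp finmap monalg.
(* fprod is the free product, not the type of dependent finite functions *)
Import Pilot.Defs.

Set Implicit Arguments.
Unset Strict Implicit.
Unset Printing Implicit Defensive.

(** Both notions are compared with one formula for mixed moments: if operators
    T_1, ..., T_n act on the free product through the left and right
    representations of the two spaces, then the vacuum expectation of their
    product is the sum over the bi-non-crossing partitions of the product, over
    the blocks, of the cumulants of the blocks, where a block using operators of
    both spaces counts for 0 ([moment_formula]).

    If the families are bi-free, their mixed moments are therefore given by such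
    a sum; since moments determine cumulants recursively ([kappa_unique_word]),
    the weights in this sum are the cumulants, and those of mixed blocks vanish.
    Conversely, each family is represented on the algebra itself by left
    multiplications, with 1 as state-vector; the moment formula computes the
    mixed moments in the free product, and when the mixed cumulants vanish it is
    also the moment-cumulant formula in the algebra.

    The moment formula is proved with a Fock space on which it is visible. Apply
    the operators from the last one to the first. A bi-non-crossing partition is
    then built by adding points at the left or at the right end of a picture; at
    any time some blocks are closed, and the others are open and arranged in a
    row from left to right. A new point starts a block or joins the extreme open
    block on its side, and its block then either stays open or is closed for
    good. The Fock space has the rows of open blocks as basis, and the operator of
    a point is the sum of these possibilities, a closed block contributing its
    weight. The vacuum coefficient of a product of such operators is thus a sum
    over all histories with no block left open, that is over the bi-non-crossing
    partitions ([diagramsP], [mem_BNC], [fock_moment]).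

    It remains to see that the free product has the same vacuum expectations as
    the Fock space. A vector x of one of the two spaces and a vector y of the
    Fock space are twins if all operators of that space give them the same
    moments; by the moment-cumulant formula the two state-vectors are twins. The
    tensors of centred vectors x_1, ..., x_m in the free product and the
    products y_1 ... y_m of their twins span a linear relation which both
    actions respect, because each action modifies only the extreme factor
    ([related_rep_op]), and on this relation the vacuum coefficients agree
    ([related_coef], [free_product_moment]). *)

(** * Inserting an extreme point into a non-crossing diagram *)

(** A partially built non-crossing partition: the set of its closed blocks, and
    the row of its open blocks in the order of the picture. *)
Definition diagram (T : finType) : Type := {set {set T}} * seq {set T}.

Definition has_block (T : finType) (st : diagram T) (V : {set T}) : bool :=
  (V \in st.1) || (V \in st.2).

Section Diagrams.
Variables (T : finType) (lt : rel T).
Implicit Types (V W : {set T}) (D : {set T}) (st : diagram T) (t : seq {set T}).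

Definition before V W : bool := [forall a in V, forall b in W, lt a b].

Lemma beforeP V W : reflect (forall a b, a \in V -> b \in W -> lt a b) (before V W).
Proof.
apply: (iffP forall_inP) => [h a b aV|h a aV]; first exact/forall_inP/h.
by apply/forall_inP => b; exact: h.
Qed.

(** The open blocks will receive further points from outside, so no other block
    may cover a point of theirs: two open blocks must not even interlace, whence
    the order of the row, and [valid_open] holds for closed blocks. *)
Record valid D st : Prop := Valid {
  valid_sub : forall V, has_block st V -> V != set0 /\ V \subset D;
  valid_cover : forall a, a \in D -> exists2 V, has_block st V & a \in V;
  valid_disj : forall V W a, has_block st V -> has_block st W ->
    a \in V -> a \in W -> V = W;
  valid_closed : forall V, V \in st.1 -> V \notin st.2;
  valid_sorted : pairwise before st.2;
  valid_open : forall V W a b c, V \in st.1 -> W \in st.2 ->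
    a \in V -> b \in W -> c \in V -> lt a b -> lt b c -> False;
  valid_nc : forall V W a b c d, V \in st.1 -> W \in st.1 ->
    a \in V -> b \in W -> c \in V -> d \in W -> lt a b -> lt b c -> lt c d -> V = W }.

(** The empty set stands for the absence of an open block, so that starting a
    block and joining the first open one become the same operation. *)
Definition push V t := if V == set0 then t else V :: t.

Definition pops t : seq ({set T} * seq {set T}) :=
  (set0, t) :: (if t is V :: t' then [:: (V, t')] else [::]).

(** The ways to add a point before all others: it joins the block popped from
    the row, and this block is put back in the row or closed. *)
Definition insertions (k : T) st : seq (diagram T) :=
  flatten [seq [:: (st.1, (k |: p.1) :: p.2); ((k |: p.1) |: st.1, p.2)] | p <- pops st.2].

Definition removal (k : T) st : diagram T :=
  let W := head set0 st.2 in
  if k \in W then (st.1, push (W :\ k) (behead st.2))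
  else let W := odflt set0 [pick W in st.1 | k \in W] in
    (st.1 :\ W, push (W :\ k) st.2).

Hypothesis irr : irreflexive lt.
Hypothesis trans : transitive lt.
Hypothesis total : forall a b, a != b -> lt a b || lt b a.

Section Step.
Variables (D : {set T}) (k : T).
Hypothesis kD : k \notin D.
Hypothesis k_min : forall b, b \in D -> lt k b.

Let notk st V : valid D st -> has_block st V -> k \notin V.
Proof. by move=> vs /(valid_sub vs)[_ /subsetP sV]; apply: contra kD => /sV. Qed.

Let lt_asym a b : lt a b -> lt b a -> False.
Proof. by move=> ab ba; have := trans ab ba; rewrite irr. Qed.

Lemma push_pops st p : valid D st -> p \in pops st.2 -> push p.1 p.2 = st.2.
Proof.
move=> vs; rewrite inE => /orP[/eqP->|]; first by rewrite /push eqxx.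
case: st vs => C [|V t] //= vs; rewrite inE => /eqP-> /=; rewrite /push.
have [/negbTE-> //] : V != set0 /\ V \subset D.
by apply: (valid_sub vs); rewrite /has_block /= inE eqxx orbT.
Qed.

Lemma pops_push V t : (V, t) \in pops (push V t).
Proof.
rewrite /push /pops; case: eqP => [->|_]; first by rewrite !inE eqxx.
by rewrite !inE eqxx orbT.
Qed.

Lemma mem_push V t W : (W \in push V t) = ((V != set0) && (W == V)) || (W \in t).
Proof. by rewrite /push; case: eqP => //= _; rewrite inE. Qed.

Lemma pairwise_push V t :
  pairwise before (push V t) = all (before V) t && pairwise before t.
Proof.
rewrite /push; case: eqP => //= ->; symmetry.
rewrite andb_idl // => _; apply/allP => W _; apply/beforeP => a b.
by rewrite inE.
Qed.

Lemma insertionsP st st' : reflect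
  (exists p, p \in pops st.2 /\
    (st' = (st.1, (k |: p.1) :: p.2) \/ st' = ((k |: p.1) |: st.1, p.2)))
  (st' \in insertions k st).
Proof.
apply: (iffP flattenP) => [[l /mapP[p pp ->]]|[p [pp e]]].
  by rewrite !inE => /orP[]/eqP->; exists p; split=> //; [left|right].
exists [:: (st.1, (k |: p.1) :: p.2); ((k |: p.1) |: st.1, p.2)].
  by apply/mapP; exists p.
by rewrite !inE; case: e => ->; rewrite eqxx ?orbT.
Qed.

Lemma valid_insert_open C V t : valid D (C, push V t) -> valid (k |: D) (C, (k |: V) :: t).
Proof.
move=> vs; set W := k |: V.
have hb U : has_block (C, W :: t) U -> U = W \/ has_block (C, push V t) U.
  rewrite /has_block /= inE mem_push => /orP[->|/orP[/eqP->|->]]; rewrite ?orbT; auto.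
have Vb a : a \in V -> has_block (C, push V t) V.
  move=> aV; rewrite /has_block mem_push eqxx andbT; apply/orP; right; apply/orP; left.
  by apply/set0Pn; exists a.
have nVt a : a \in V -> V \notin t.
  move=> aV; have := valid_sorted vs; rewrite pairwise_push => /andP[/allP bV _].
  by apply/negP => /bV /beforeP/(_ a a aV aV); rewrite irr.
have dis U a : U \in C \/ U \in t -> a \in U -> a \in W -> False.
  move=> UCt aU; have bU : has_block (C, push V t) U.
    by rewrite /has_block mem_push; case: UCt => ->; rewrite ?orbT.
  rewrite !inE => /orP[/eqP ak|aV]; first by have := notk vs bU; rewrite -ak aU.
  have UV := valid_disj vs bU (Vb a aV) aU aV; rewrite UV in UCt.
  case: UCt => [/(valid_closed vs)|]; last exact/negP/(nVt a).
  by rewrite mem_push eqxx andbT; case/norP=> /negPn/eqP V0; rewrite V0 inE in aV.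
split=> /=.
- move=> U /hb[->|/(valid_sub vs)[U0 UD]].
    split; first by apply/set0Pn; exists k; rewrite setU11.
    rewrite setUS //; have [->|[a aV]] := set_0Vmem V; first exact: sub0set.
    by have [] := valid_sub vs (Vb a aV).
  by split=> //; apply: subset_trans UD _; exact: subsetUr.
- move=> a; rewrite !inE => /orP[/eqP->|/(valid_cover vs)[U bU aU]].
    by exists W; rewrite /has_block /= ?inE ?eqxx ?orbT.
  move: bU; rewrite /has_block /= mem_push => /orP[UC|/orP[/andP[_ /eqP UV]|Ut]].
  + by exists U => //; rewrite /has_block /= UC.
  + by exists W; rewrite /has_block /= ?inE ?eqxx ?orbT // -UV aU orbT.
  + by exists U => //; rewrite /has_block /= inE Ut !orbT.
- move=> U1 U2 a; rewrite /has_block /= !inE.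
  case/orP=> [U1C|/orP[/eqP->|U1t]]; case/orP=> [U2C|/orP[/eqP->|U2t]] // a1 a2;
    try (by case: (@dis U1 a); auto); try (by case: (@dis U2 a); auto);
    by apply: (valid_disj vs _ _ a1 a2); rewrite /has_block mem_push ?U1C ?U2C ?U1t ?U2t ?orbT.
- move=> U UC; rewrite inE negb_or; have := valid_closed vs UC; rewrite mem_push.
  case/norP=> _ ->; rewrite andbT; apply/eqP => UW.
  by case: (@dis U k); rewrite ?UW ?setU11; auto; left; rewrite -UW.
- have := valid_sorted vs; rewrite pairwise_push => /andP[/allP bV ->]; rewrite andbT.
  apply/allP => U Ut; apply/beforeP => a b; rewrite !inE => /orP[/eqP->|aV] bU.
    apply: k_min; have [_ /subsetP] : U != set0 /\ U \subset D.
      by apply: (valid_sub vs); rewrite /has_block mem_push Ut !orbT.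
    exact.
  by have /beforeP := bV _ Ut; apply.
- move=> U1 U2 a b c U1C; rewrite inE => /orP[/eqP->|U2t] aU bU cU ab bc; last first.
    by apply: (valid_open vs U1C _ aU bU cU ab bc); rewrite mem_push U2t orbT.
  move: bU; rewrite !inE => /orP[/eqP bk|bV].
    apply: (lt_asym ab); rewrite bk; apply: k_min.
    have [_ /subsetP] : U1 != set0 /\ U1 \subset D.
      by apply: (valid_sub vs); rewrite /has_block /= U1C.
    exact.
  apply: (valid_open vs U1C _ aU bV cU ab bc); rewrite mem_push eqxx andbT.
  by apply/orP; left; apply/set0Pn; exists b.
- exact: (valid_nc vs).
Qed.

(** Closing the first open block creates no crossing: it precedes the other open
    blocks, and a crossing with a closed block would cover one of its points. *)
Lemma valid_insert_closed C V t : valid D (C, push V t) -> valid (k |: D) ((k |: V) |: C, t).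
Proof.
move=> vs; have vo := valid_insert_open vs; set W := k |: V in vo *.
have hb U : has_block (W |: C, t) U = has_block (C, W :: t) U.
  by rewrite /has_block /= !inE; case: (U == W); case: (U \in C).
have WC : W \notin C.
  by apply/negP => /(valid_closed vo); rewrite inE eqxx.
have Vpush b : b \in V -> V \in push V t.
  by move=> bV; rewrite mem_push eqxx andbT; apply/orP; left; apply/set0Pn; exists b.
have := valid_sorted vo; rewrite /= => /andP[/allP bW st].
have inD U a : has_block (C, push V t) U -> a \in U -> a \in D.
  by move=> /(valid_sub vs)[_ /subsetP]; apply.
split=> //=.
- by move=> U; rewrite hb; exact: (valid_sub vo).
- by move=> a /(valid_cover vo)[U bU aU]; exists U; rewrite ?hb.
- by move=> U1 U2 a; rewrite !hb; exact: (valid_disj vo).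
- move=> U; rewrite !inE => /orP[/eqP->|/(valid_closed vo)]; last by rewrite inE => /norP[].
  by apply/negP => /bW /beforeP/(_ k k); rewrite setU11 irr => /(_ isT isT).
- move=> U1 U2 a b c; rewrite !inE => /orP[/eqP->|U1C] U2t aU bU cU ab bc.
    by have /beforeP/(_ c b cU bU) cb := bW _ U2t; exact: lt_asym bc cb.
  by apply: (valid_open vo U1C _ aU bU cU ab bc); rewrite inE U2t orbT.
- move=> U1 U2 a b c d; rewrite !inE.
  case/orP=> [/eqP->|U1C]; case/orP=> [/eqP->|U2C] // aU bU cU dU ab bc cd; last first.
  + exact: (valid_nc vs U1C U2C aU bU cU dU ab bc cd).
  + exfalso; move: bU; rewrite !inE => /orP[/eqP bk|bV].
      by apply: (lt_asym ab); rewrite bk; apply: k_min; apply: inD aU; rewrite /has_block /= U1C.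
    exact: (valid_open vs U1C (Vpush b bV) aU bV cU ab bc).
  + exfalso; move: cU; rewrite !inE => /orP[/eqP ck|cV].
      by apply: (lt_asym bc); rewrite ck; apply: k_min; apply: inD bU; rewrite /has_block /= U2C.
    exact: (valid_open vs U2C (Vpush c cV) bU cV dU bc cd).
Qed.

Lemma valid_insertions st st' : valid D st -> st' \in insertions k st -> valid (k |: D) st'.
Proof.
case: st => C t vs /insertionsP[[V t'] [pp e]].
have := push_pops vs pp; rewrite /= => et; rewrite -et in vs.
by case: e => -> /=; [exact: valid_insert_open|exact: valid_insert_closed].
Qed.

(** So a diagram has one parent only, which keeps the enumeration of diagrams free
    of repetitions. *)
Lemma removal_insertions st st' : valid D st -> st' \in insertions k st -> removal k st' = st.
Proof.
case: st => C t vs /insertionsP[[V t'] [pp e]].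
have := push_pops vs pp; rewrite /= => et; rewrite -et in vs pp *.
have kV : k \notin V.
  have [->|[a aV]] := set_0Vmem V; first by rewrite inE.
  apply: (notk vs); rewrite /has_block mem_push eqxx andbT.
  by apply/orP; right; apply/orP; left; apply/set0Pn; exists a.
have nC U : U \in C -> k \notin U by move=> UC; apply: (notk vs); rewrite /has_block /= UC.
case: e => -> /=; rewrite /removal /=; first by rewrite setU11 setU1K.
have -> : k \in head set0 t' = false.
  case: t' {pp et} vs => [|U t'] vs; first by rewrite inE.
  by apply/negbTE/(notk vs); rewrite /has_block mem_push inE eqxx !orbT.
case: pickP => [W|/(_ (k |: V))]; last by rewrite setU11 setU11.
rewrite !inE => /andP[/orP[/eqP->|/nC/negP] //] _.
by rewrite /= setU1K // setU1K //; apply: contraL (setU11 k V) => /nC.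
Qed.

Lemma uniq_insertions st : valid D st -> uniq (insertions k st).
Proof.
case: st => C t vs; rewrite /insertions /pops.
have nC U : U \in C -> k \notin U by move=> UC; apply: (notk vs); rewrite /has_block /= UC.
have nkC V : (k |: V) |: C != C.
  apply/eqP => e; have : k |: V \in C by rewrite -e setU11.
  by move/nC; rewrite setU11.
have ns (U : {set T}) t' : (U :: t' == t') = false.
  by apply/negP => /eqP/(congr1 size) /eqP; rewrite gtn_eqF.
case: t vs => [|V t] vs /=; rewrite !inE !xpair_eqE /= ?andbF //= ?andbT.
have e2 : ([:: k |: set0, V & t] == t) = false.
  by apply/negP => /eqP/(congr1 size) /= /eqP; rewrite gtn_eqF.
by rewrite e2 !eqseq_cons !ns (negbTE (nkC _)) !andbF.
Qed.

(** A block that loses its first point was open before, unless nothing is left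
    of it. *)
Lemma valid_delete_open C W t : k \in W -> valid (k |: D) (C, W :: t) ->
  valid D (C, push (W :\ k) t).
Proof.
move=> kW vs.
have bW : has_block (C, W :: t) W by rewrite /has_block /= inE eqxx orbT.
have up U a : has_block (C, push (W :\ k) t) U -> a \in U ->
    exists U', [/\ has_block (C, W :: t) U', a \in U' & U = U' :\ k].
  have nk U' : has_block (C, W :: t) U' -> U' != W -> k \notin U'.
    by move=> bU'; apply: contraNN => kU'; apply/eqP/(valid_disj vs bU' bW kU' kW).
  have nW U' : (U' \in C) || (U' \in t) -> U' != W.
    case/orP=> [/(valid_closed vs)|U't]; first by rewrite inE => /norP[].
    have := valid_sorted vs; rewrite /= => /andP[/allP/(_ _ U't)/beforeP bf _].
    by apply/eqP => e; have := bf k k kW; rewrite e kW irr => /(_ isT).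
  rewrite {1}/has_block /= mem_push => /orP[UC|/orP[/andP[_ /eqP->]|Ut]] aU.
  - have bU : has_block (C, W :: t) U by rewrite /has_block /= UC.
    exists U; split=> //; apply/setP => b; rewrite !inE; case: eqP => //= ->.
    by apply/negbTE/nk => //; apply: nW; rewrite UC.
  - by exists W; split=> //; move: aU; rewrite inE => /andP[].
  - have bU : has_block (C, W :: t) U by rewrite /has_block /= inE Ut !orbT.
    exists U; split=> //; apply/setP => b; rewrite !inE; case: eqP => //= ->.
    by apply/negbTE/nk => //; apply: nW; rewrite Ut orbT.
have := valid_sorted vs; rewrite /= => /andP[/allP bWt srt].
split=> /=.
- move=> U bU; have U0 : U != set0.
    move: bU; rewrite /has_block /= mem_push => /orP[UC|/orP[/andP[U0 /eqP->] //|Ut]].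
      by have [] := valid_sub vs (_ : has_block (C, W :: t) U); rewrite ?/has_block /= ?UC.
    by have [] := valid_sub vs (_ : has_block (C, W :: t) U);
      rewrite ?/has_block /= ?inE ?Ut ?orbT.
  split=> //; apply/subsetP => a aU; have [U' [bU' aU' e]] := up U a bU aU.
  have [_ /subsetP/(_ a aU')] := valid_sub vs bU'.
  by move: aU; rewrite e !inE => /andP[/negbTE->].
- move=> a aD; have ak : a != k by apply: contraNneq kD => <-.
  have [|U bU aU] := valid_cover vs (_ : a \in k |: D); first by rewrite inE aD orbT.
  move: bU; rewrite /has_block /= inE => /orP[UC|/orP[/eqP UW|Ut]].
  + by exists U => //; rewrite UC.
  + exists (W :\ k); last by rewrite !inE ak -UW.
    rewrite mem_push eqxx andbT; apply/orP; right; apply/orP; left.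
    by apply/set0Pn; exists a; rewrite !inE ak -UW.
  + by exists U => //; rewrite mem_push Ut !orbT.
- move=> U1 U2 a b1 b2 a1 a2.
  have [U1' [b1' a1' ->]] := up _ _ b1 a1; have [U2' [b2' a2' ->]] := up _ _ b2 a2.
  by rewrite (valid_disj vs b1' b2' a1' a2').
- move=> U UC; rewrite mem_push negb_or.
  have := valid_closed vs UC; rewrite inE => /norP[/eqP UW ->]; rewrite andbT.
  apply/negP => /andP[/set0Pn[a aW] /eqP UWk]; apply: UW.
  apply: (valid_disj vs _ bW (a := a)); rewrite ?/has_block /= ?UC ?UWk //.
  by move: aW; rewrite inE => /andP[].
- rewrite pairwise_push srt andbT; apply/allP => U /bWt/beforeP bf.
  by apply/beforeP => a b; rewrite inE => /andP[_]; exact: bf.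
- move=> U1 U2 a b c U1C; rewrite mem_push => /orP[/andP[_ /eqP->]|U2t] aU bU cU ab bc.
    apply: (valid_open vs U1C _ aU _ cU ab bc); first exact: mem_head.
    by move: bU; rewrite inE => /andP[].
  by apply: (valid_open vs U1C _ aU bU cU ab bc); rewrite inE U2t orbT.
- exact: (valid_nc vs).
Qed.

(** Reopening the closed block W of the first point k is legitimate: a point of
    an open block lying before some point of W would be covered by W, as k comes
    first, and a closed block covering a point of W would cross W. *)
Lemma valid_delete_closed (C : {set {set T}}) W t :
  k \in W -> W \in C -> valid (k |: D) (C, t) ->
  valid D (C :\ W, push (W :\ k) t).
Proof.
move=> kW WC vs.
have Wt : W \notin t by exact: (valid_closed vs WC).
have bW : has_block (C, t) W by rewrite /has_block /= WC.
suff vo : valid (k |: D) (C :\ W, W :: t) by exact: valid_delete_open.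
have hb U : has_block (C :\ W, W :: t) U = has_block (C, t) U.
  rewrite /has_block /= !inE; have [->|] := eqVneq U W; last by [].
  by rewrite WC.
have inD U b : U \in t -> b \in U -> b \in D.
  move=> Ut bU; have bl : has_block (C, t) U by rewrite /has_block /= Ut orbT.
  have [_ /subsetP/(_ b bU)] := valid_sub vs bl.
  rewrite inE => /orP[|//]; rewrite inE => /eqP bk; rewrite bk in bU.
  by rewrite (valid_disj vs bl bW bU kW) (negbTE Wt) in Ut.
split=> /=.
- by move=> U; rewrite hb; exact: (valid_sub vs).
- by move=> a /(valid_cover vs)[U bU aU]; exists U; rewrite ?hb.
- by move=> U1 U2 a; rewrite !hb; exact: (valid_disj vs).
- by move=> U; rewrite !inE => /andP[/negbTE-> /(valid_closed vs)].
- rewrite (valid_sorted vs) andbT; apply/allP => U Ut; apply/beforeP => a b aW bU.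
  have kb := k_min (inD _ _ Ut bU).
  have [<-|ka] := eqVneq k a; first exact: kb.
  have [ab|] := eqVneq a b.
    have bl : has_block (C, t) U by rewrite /has_block /= Ut orbT.
    by rewrite -ab in bU; rewrite (valid_disj vs bl bW bU aW) (negbTE Wt) in Ut.
  move/total/orP => [//|ba]; exfalso.
  exact: (valid_open vs WC Ut kW bU aW kb ba).
- move=> U1 U2 a b c; rewrite !inE => /andP[U1W U1C].
  move=> /orP[/eqP->|U2t] aU bU cU ab bc; last first.
    exact: (valid_open vs U1C U2t aU bU cU ab bc).
  have bl : has_block (C, t) U1 by rewrite /has_block /= U1C.
  have ak : a != k.
    by apply: contraNneq U1W => ak; apply/eqP/(valid_disj vs bl bW aU); rewrite ak.
  have ka : lt k a.
    apply: k_min; have [_ /subsetP/(_ a aU)] := valid_sub vs bl.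
    by rewrite !inE (negbTE ak).
  by case/eqP: U1W; symmetry; exact: (valid_nc vs WC U1C kW aU bU cU).
- move=> U1 U2 a b c d; rewrite !inE => /andP[_ U1C] /andP[_ U2C].
  exact: (valid_nc vs U1C U2C).
Qed.

Lemma valid_removal st : valid (k |: D) st ->
  valid D (removal k st) /\ st \in insertions k (removal k st).
Proof.
case: st => C t vs; rewrite /removal /=.
case: ifP => [kh|nkh].
  case: t kh vs => [|W t] /= kW vs; first by rewrite inE in kW.
  split; first exact: valid_delete_open.
  apply/insertionsP; exists (W :\ k, t); rewrite pops_push; split=> //.
  by left; rewrite /= setD1K.
have [W bW kW] := valid_cover vs (setU11 k D).
have WC : W \in C.
  move: bW; rewrite /has_block /= => /orP[//|]; case: t vs nkh => [//|U t] vs /= kU.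
  rewrite inE => /orP[/eqP WU|Wt]; first by rewrite WU kU in kW.
  have bU : has_block (C, U :: t) U by rewrite /has_block /= inE eqxx orbT.
  have [/set0Pn[a aU] /subsetP/(_ a aU)] := valid_sub vs bU.
  have ak : a != k by apply: contraFneq kU => <-.
  rewrite !inE (negbTE ak) /= => /k_min ka.
  have := valid_sorted vs; rewrite /= => /andP[/allP/(_ _ Wt)/beforeP/(_ a k aU kW) ak' _].
  by case: (lt_asym ka ak').
case: pickP => [{bW kW WC}W /andP[WC kW]|/(_ W)]; last by rewrite WC kW.
split; first exact: valid_delete_closed.
apply/insertionsP; exists (W :\ k, t); rewrite pops_push; split=> //.
by right; rewrite /= setD1K // setD1K.
Qed.
End Step.
End Diagrams.

(** * Bi-non-crossing partitions as diagrams *)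

Section Mirror.
Variable T : finType.

(** Adding a point after all others is adding it before all others in the
    reversed order; only the row has to be reversed. *)
Definition mirror (st : diagram T) : diagram T := (st.1, rev st.2).

Lemma mirrorK : involutive mirror.
Proof. by case=> C t; rewrite /mirror /= revK. Qed.

Lemma pairwise_rev (S : Type) (r : rel S) s :
  pairwise r (rev s) = pairwise (fun x y => r y x) s.
Proof.
elim: s => //= x s IH; rewrite rev_cons -cats1 pairwise_cat IH /= andbT andbC.
by rewrite /allrel all_rev andbC; congr (_ && _); apply: eq_all => y; rewrite /= andbT.
Qed.

Lemma valid_mirror (lt : rel T) D st :
  valid lt D st -> valid (fun a b => lt b a) D (mirror st).
Proof.
have hb V : has_block (mirror st) V = has_block st V by rewrite /has_block mem_rev.
case=> v1 v2 v3 v4 v5 v6 v7; split=> /=.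
- by move=> V; rewrite hb; exact: v1.
- by move=> a /v2[V bV aV]; exists V; rewrite ?hb.
- by move=> V W a; rewrite !hb; exact: v3.
- by move=> V VC; rewrite mem_rev; exact: v4.
- rewrite pairwise_rev; apply: sub_pairwise v5 => V W /beforeP h.
  by apply/beforeP => a b aV bW; exact: h.
- move=> V W a b c VC; rewrite mem_rev => Wt aV bW cV ab bc.
  exact: (v6 V W c b a).
- move=> V W a b c d VC WC aV bW cV dW ab bc cd.
  by symmetry; apply: (v7 W V d c b a).
Qed.
End Mirror.

Section BNCDiagrams.
Variables (n : nat) (chi : 'I_n -> bool).

(** The order in which crossings of partitions in BNC(chi) are read. *)
Definition schi_lt (a b : 'I_n) : bool := ((schi chi)^-1%g a < (schi chi)^-1%g b)%N.

Lemma schi_lt_irr : irreflexive schi_lt.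
Proof. by move=> a; rewrite /schi_lt ltnn. Qed.

Lemma schi_lt_trans : transitive schi_lt.
Proof. by move=> b a c; exact: ltn_trans. Qed.

Lemma schi_lt_total a b : a != b -> schi_lt a b || schi_lt b a.
Proof. by rewrite /schi_lt -neq_ltn; apply: contraNN => /eqP/ord_inj/perm_inj->. Qed.

Lemma schi_inv_index i : (schi chi)^-1%g i = index i (schi_seq chi) :> nat.
Proof.
have := permKV (schi chi) i; rewrite permE /schi_fun; set p := ((schi chi)^-1%g i).
have sp : (p < size (schi_seq chi))%N by rewrite schi_size.
by move=> e; rewrite -{1}e index_uniq // schi_uniq.
Qed.

Lemma enum_ord_sorted (P : pred 'I_n) : sorted (fun a b : 'I_n => a < b)%N (enum P).
Proof.
rewrite /enum_mem -enumT; apply: sorted_filter => [b a c|]; first exact: ltn_trans.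
by have := iota_ltn_sorted 0 n; rewrite -val_enum_ord sorted_map.
Qed.

(** Since points are added from the last to the first, this and the next lemma
    say that a new left point comes first and a new right point comes last. *)
Lemma schi_lt_left (a b : 'I_n) : chi a -> (a < b)%N -> schi_lt a b.
Proof.
move=> ca ab; rewrite /schi_lt !schi_inv_index /schi_seq !index_cat !mem_enum !inE ca.
set s := enum _; have ins : a \in s by rewrite mem_enum inE.
have [cb|cb] := boolP (chi b); last first.
  by apply: leq_trans (leq_addr _ _); rewrite index_mem.
have ibs : b \in s by rewrite mem_enum inE.
rewrite ltnNge leq_eqVlt; apply/norP; split.
  apply/eqP => /(congr1 (nth a s)); rewrite !nth_index // => ba.
  by rewrite ba ltnn in ab.
have tr : transitive (fun a b : 'I_n => a < b)%N by move=> ? ? ?; exact: ltn_trans.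
apply/negP => /(sorted_ltn_index tr (enum_ord_sorted _) _ _ ibs ins).
by rewrite ltnNge ltnW.
Qed.

Lemma schi_lt_right (a b : 'I_n) : ~~ chi a -> (a < b)%N -> schi_lt b a.
Proof.
move=> ca ab; rewrite /schi_lt !schi_inv_index /schi_seq !index_cat !mem_enum !inE (negbTE ca).
set s := enum [pred i | ~~ chi i]; have ins : a \in rev s by rewrite mem_rev mem_enum inE.
have [cb|cb] := boolP (chi b).
  by apply: leq_trans (leq_addr _ _); rewrite index_mem mem_enum.
rewrite ltn_add2l.
have ibs : b \in rev s by rewrite mem_rev mem_enum inE.
have srt : sorted (fun a b : 'I_n => b < a)%N (rev s).
  by rewrite rev_sorted; exact: enum_ord_sorted.
rewrite ltnNge leq_eqVlt; apply/norP; split.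
  apply/eqP => /(congr1 (nth a (rev s))); rewrite !nth_index // => ba.
  by rewrite ba ltnn in ab.
have tr : transitive (fun a b : 'I_n => b < a)%N.
  by move=> ? ? ? h h'; exact: ltn_trans h' h.
apply/negP => /(sorted_ltn_index tr srt _ _ ins ibs).
by rewrite ltnNge ltnW.
Qed.

Definition insert_point (k : 'I_n) (st : diagram 'I_n) : seq (diagram 'I_n) :=
  if chi k then insertions k st else map (@mirror _) (insertions k (mirror st)).

Definition diagrams (s : seq 'I_n) : seq (diagram 'I_n) :=
  foldr (fun k l => flatten (map (insert_point k) l)) [:: (set0, [::])] s.

Lemma valid_nil st : valid schi_lt set0 st <-> st = (set0, [::]).
Proof.
split=> [vs|->]; last first.
  by split=> //= V; try move=> W a; rewrite /has_block ?inE.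
have nb V : has_block st V = false.
  by apply/negP => /(valid_sub vs)[V0]; rewrite subset0 (negbTE V0).
case: st vs nb => C [|V t] vs nb; last by have := nb V; rewrite /has_block inE eqxx orbT.
by congr pair; apply/setP => V; have := nb V; rewrite /has_block orbF inE.
Qed.

(** Right points reduce to left ones by reflection. *)
Lemma insert_pointP (D : {set 'I_n}) (k : 'I_n) : (forall b, b \in D -> (k < b)%N) ->
  [/\ forall st st', valid schi_lt D st -> st' \in insert_point k st ->
        valid schi_lt (k |: D) st',
      forall st', valid schi_lt (k |: D) st' ->
        exists2 st, valid schi_lt D st & st' \in insert_point k st,
      forall st, valid schi_lt D st -> uniq (insert_point k st)
    & forall st1 st2 st', valid schi_lt D st1 -> valid schi_lt D st2 ->
        st' \in insert_point k st1 -> st' \in insert_point k st2 -> st1 = st2].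
Proof.
move=> kmin; have kD : k \notin D by apply/negP => /kmin; rewrite ltnn.
rewrite /insert_point; case ck: (chi k).
  have km b : b \in D -> schi_lt k b by move=> bD; exact: schi_lt_left ck (kmin b bD).
  split.
  - by move=> st st'; apply: valid_insertions => //; [exact: schi_lt_irr|exact: schi_lt_trans].
  - move=> st' vs.
    have [] := valid_removal schi_lt_irr schi_lt_trans schi_lt_total kD km vs.
    by exists (removal k st').
  - by move=> st; apply: uniq_insertions.
  - move=> st1 st2 st' v1 v2 /(removal_insertions kD v1) <- /(removal_insertions kD v2) <- //.
set lt' := fun a b => schi_lt b a.
have irr' : irreflexive lt' by exact: schi_lt_irr.
have tr' : transitive lt' by move=> b a c ab bc; exact: schi_lt_trans bc ab.
have tot' a b : a != b -> lt' a b || lt' b a by rewrite orbC; exact: schi_lt_total.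
have km b : b \in D -> lt' k b by move=> bD; exact: schi_lt_right (negbT ck) (kmin b bD).
split.
- move=> st st' /valid_mirror vs /mapP[st'' i ->].
  by apply: (@valid_mirror _ lt'); apply: valid_insertions i.
- move=> st' /valid_mirror vs.
  have [] := valid_removal irr' tr' tot' kD km vs.
  set st := removal _ _ => vst i; exists (mirror st); first exact: (@valid_mirror _ lt').
  by apply/mapP; exists (mirror st'); rewrite mirrorK.
- move=> st /valid_mirror vs; rewrite map_inj_uniq; last exact: can_inj (@mirrorK _).
  exact: (uniq_insertions kD vs).
- move=> st1 st2 st' /valid_mirror v1 /valid_mirror v2 /mapP[s1 i1 ->] /mapP[s2 i2].
  move/(can_inj (@mirrorK _)) => e; rewrite -e in i2.
  apply: (can_inj (@mirrorK _)).
  by rewrite -(removal_insertions kD v1 i1) -(removal_insertions kD v2 i2).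
Qed.

(** Every diagram is produced exactly once, because the last insertion can be
    read off from it. *)
Lemma diagramsP s : pairwise (fun a b : 'I_n => a < b)%N s ->
  uniq (diagrams s) /\ forall st, st \in diagrams s <-> valid schi_lt [set i in s] st.
Proof.
elim: s => [|k s IH] /= => [_|/andP[/allP ks /IH[us ms]]].
  split=> // st; have -> : [set i in [::]] = set0 :> {set 'I_n}.
    by apply/setP => i; rewrite !inE.
  by rewrite valid_nil inE; split=> [/eqP|->].
have -> : [set i in k :: s] = k |: [set i in s] by apply/setP => i; rewrite !inE.
have [|ins del un inj] := @insert_pointP [set i in s] k; first by move=> b; rewrite inE => /ks.
split; last first.
  move=> st; split=> [/flattenP[l /mapP[st0 /ms v0 ->]]|/del[st0 /ms v0 i]]; first exact: ins.
  by apply/flattenP; exists (insert_point k st0) => //; apply/mapP; exists st0.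
have {}ms st : st \in diagrams s -> valid schi_lt [set i in s] st by move/ms.
elim: (diagrams s) us ms => //= st l IHl /andP[stl ul] ms.
rewrite cat_uniq un ?IHl ?andbT //; last first.
- by apply: ms; rewrite mem_head.
- by move=> st' stl'; apply: ms; rewrite inE stl' orbT.
apply/hasPn => st' /flattenP[_ /mapP[st2 st2l ->] i2]; apply/negP => i1.
move/negP: stl; apply; suff -> : st = st2 by [].
by apply: inj i1 i2; apply: ms; rewrite inE ?eqxx ?st2l ?orbT.
Qed.

Lemma mem_BNC C : C \in BNC chi <-> valid schi_lt [set: 'I_n] (C, [::]).
Proof.
rewrite inE; set sI := fun V : {set 'I_n} => (schi chi)^-1%g @: V.
split=> [/andP[/and3P[/eqP cov /trivIsetP tri n0] nc]|vs].
  split=> //=.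
  - move=> V; rewrite /has_block orbF /= => VC; split; last exact: subsetT.
    by apply: contraNneq n0 => <-.
  - move=> a _; have : a \in cover C by rewrite cov inE.
    by case/bigcupP => V VC aV; exists V; rewrite // /has_block /= VC.
  - move=> V W a; rewrite /has_block !orbF /= => VC WC aV aW; apply/eqP.
    apply: contraT => VW; have /pred0P/(_ a) := tri _ _ VC WC VW.
    by rewrite /= aV aW.
  - move=> V W a b c d VC WC aV bW cV dW ab bc cd; apply/eqP/contraT => VW.
    move/forall_inP/(_ _ (imset_f sI VC))/forall_inP/(_ _ (imset_f sI WC)): nc.
    rewrite (inj_eq (imset_inj (@perm_inj _ _))) VW /=.
    move/forallP/(_ ((schi chi)^-1%g a))/forallP/(_ ((schi chi)^-1%g b)).
    move/forallP/(_ ((schi chi)^-1%g c))/forallP/(_ ((schi chi)^-1%g d)).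
    by rewrite !imset_f // !andbT; case/and3P.
apply/andP; split.
  apply/and3P; split.
  - apply/eqP/setP => a; rewrite inE; have [V bV aV] := valid_cover vs (in_setT a).
    by apply/bigcupP; exists V => //; move: bV; rewrite /has_block orbF.
  - apply/trivIsetP => V W VC WC; apply: contraNT => /pred0Pn[a /andP[/= aV aW]].
    by apply/eqP/(valid_disj vs _ _ aV aW); rewrite /has_block /= ?VC ?WC.
  - by apply/negP => C0; have [] := valid_sub vs (_ : has_block (C, [::]) set0);
      rewrite ?/has_block /= ?C0 ?eqxx.
apply/forall_inP => _ /imsetP[V VC ->]; apply/forall_inP => _ /imsetP[W WC ->].
apply/implyP => VW; do 4![apply/forallP => ?]; apply/negP.
case/and5P => ab bc cd /imsetP[a aV ea].
case/and3P => /imsetP[b bW eb] /imsetP[c cV ec] /imsetP[d dW ed].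
rewrite ea eb ec ed in ab bc cd.
have e : V = W by exact: (valid_nc vs VC WC aV bW cV dW ab bc cd).
by rewrite e eqxx in VW.
Qed.

End BNCDiagrams.

Import GRing.Theory.
Local Open Scope ring_scope.

(** * Free algebras *)

(** Left algebras lack the compatibility of scalars with the right factor; it
    can be checked on a spanning set. *)
Lemma scale_mulr_ind (K : fieldType) (A : lalgType K) (T : Type) (w : T -> A) :
  (forall P : A -> Prop, P 0 -> (forall c x y, P x -> P y -> P (c *: x + y)) ->
    (forall s, P (w s)) -> forall x, P x) ->
  (forall (c : K) s t, c *: (w s * w t) = w s * (c *: w t)) ->
  forall (c : K) (x y : A), c *: (x * y) = x * (c *: y).
Proof.
move=> ind basis c x; elim/ind: x c => [|a x x' IHx IHx'|s] c y.
- by rewrite !mul0r scaler0.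
- by rewrite !mulrDl scalerDr IHx' -!scalerAl -IHx !scalerA mulrC.
elim/ind: y c => [|a y y' IHy IHy'|t] c; last exact: basis.
- by rewrite !(scaler0, mulr0).
by rewrite scalerDr !mulrDr scalerDr IHy' -IHy !scalerA IHy.
Qed.

(** The free algebra on T, known only by its basis of words; the monoid algebra
    of the free monoid is a model ([monoid_algebra]). *)
Record free_algebra (K : fieldType) (T : choiceType) := FreeAlgebra {
  fa_alg :> lalgType K;
  fa_scaleAr : forall (c : K) (x y : fa_alg), c *: (x * y) = x * (c *: y);
  word : seq T -> fa_alg;
  word0 : word [::] = 1;
  wordM : forall s t, word s * word t = word (s ++ t);
  free_ind : forall P : fa_alg -> Prop,
    P 0 -> (forall c x y, P x -> P y -> P (c *: x + y)) ->
    (forall s, P (word s)) -> forall x, P x;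
  free_lift : forall (W : lmodType K) (g : seq T -> W),
    exists h : {linear fa_alg -> W}, forall s, h (word s) = g s }.
Arguments word {K T f} s.

Section MonoidAlgebra.
Variables (K : fieldType) (T : choiceType).
Local Notation M := {malg K[{fmonom T}]}.

Definition malg_word (s : seq T) : M := << FMonom s >>.

Lemma malg_word0 : malg_word [::] = 1.
Proof. by rewrite /malg_word -fmoneE. Qed.

Lemma malg_wordM s t : malg_word s * malg_word t = malg_word (s ++ t).
Proof.
rewrite /malg_word malgM_def fgmulUU mulr1; congr << _ >>.
by apply/eqP; rewrite fmP fmM.
Qed.

Lemma malg_unitZ (c : K) m : << c *g m >> = c *: (<< m >> : M).
Proof. by apply/malgP => k; rewrite (mcoeffZ c (<< m >> : M)) !mcoeffU mulrnAr mulr1. Qed.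

Lemma malg_word_ind (P : M -> Prop) : P 0 ->
  (forall c x y, P x -> P y -> P (c *: x + y)) ->
  (forall s, P (malg_word s)) -> forall x, P x.
Proof.
move=> P0 Pl Ps x; rewrite (monalgE x).
elim/big_ind: _ => [//|u v Pu Pv|[s] _].
  by have := Pl 1 u v Pu Pv; rewrite (scale1r (u : M)).
by rewrite malg_unitZ; have := Pl (x@_(FMonom s)) _ _ (Ps s) P0; rewrite (addr0 (_ : M)).
Qed.

Lemma malg_word_lift (W : lmodType K) (g : seq T -> W) :
  exists h : {linear M -> W}, forall s, h (malg_word s) = g s.
Proof. by exists (flift (fun m : {fmonom T} => g m)) => s; rewrite fliftE. Qed.

Lemma malg_scaleAr (c : K) (x y : M) : c *: (x * y) = x * (c *: y).
Proof.
apply: (scale_mulr_ind malg_word_ind) => e s t.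
rewrite malg_wordM -!malg_unitZ malgM_def fgmulUU mul1r; congr << _ *g _ >>.
by apply/eqP; rewrite fmP fmM.
Qed.

Definition monoid_algebra : free_algebra K T :=
  FreeAlgebra malg_scaleAr malg_word0 malg_wordM malg_word_ind malg_word_lift.
End MonoidAlgebra.

Lemma free_algebra_morph (K : fieldType) (T : choiceType) (F : free_algebra K T)
    (B : algType K) (g : T -> B) :
  exists2 phi : {linear F -> B}, monoid_morphism phi & forall t, phi (word [:: t]) = g t.
Proof.
have [phi phiE] := free_lift F (fun s => \prod_(t <- s) g t).
exists phi; last by move=> t; rewrite phiE big_seq1.
split; first by rewrite -word0 phiE big_nil.
move=> x y; elim/free_ind: x => [|c x x' IHx IHx'|s].
- by rewrite mul0r !linear0 mul0r.
- by rewrite mulrDl -scalerAl !linearP IHx IHx' mulrDl scalerAl.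
elim/free_ind: y => [|c y y' IHy IHy'|t].
- by rewrite mulr0 !linear0 mulr0.
- by rewrite mulrDr -fa_scaleAr !linearP IHy IHy' mulrDr scalerAr.
by rewrite wordM !phiE big_cat.
Qed.

(** * The Fock space of open blocks *)

Section Fock.
Variables (K : fieldType) (L : choiceType) (col side : L -> bool).
(* the weights of the closed blocks *)
Variable f : seq L -> K.
(* The Fock space: its basis, the words in the letters [seq L], consists of the
   rows of open blocks, and the product is juxtaposition of rows. *)
Variable F : free_algebra K (seq L).

Definition free_linear (W : lmodType K) (g : seq (seq L) -> W) : {linear F -> W} :=
  projT1 (cid (free_lift F g)).

Lemma free_linearE (W : lmodType K) (g : seq (seq L) -> W) s :
  free_linear g (word s) = g s.
Proof. exact: (projT2 (cid (free_lift F g))). Qed.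

Definition vacuum_coef : {linear F -> K^o} := free_linear (fun s => (nilp s)%:R : K^o).

Lemma vacuum_coef_word s : vacuum_coef (word s) = (nilp s)%:R.
Proof. exact: free_linearE. Qed.

(** Blocks never mix the two colours, i.e. the two spaces of the free product. *)
Definition monochrome (V : seq L) := constant (map col V).

(** A block that has just received a point stays open, or is closed and leaves
    its weight. *)
Definition open_or_close (V : seq L) : F := word [:: V] + f V *: 1.

Definition left_step k (s : seq (seq L)) : F :=
  open_or_close [:: k] * word s +
  (if s is V :: s' then
     if monochrome (k :: V) then open_or_close (k :: V) * word s' else 0
   else 0).

(** A left point enters on the left of the row; a right point acts by the mirror
    image, see [fock_op]. *)
Definition left_op k : {linear F -> F} := free_linear (left_step k).

Definition flip : {linear F -> F} := free_linear (fun s => word (rev s)).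

Definition fock_op k : {linear F -> F} :=
  if side k then left_op k else flip \o (left_op k \o flip).

Lemma left_op_word k s : left_op k (word s) = left_step k s.
Proof. exact: free_linearE. Qed.

Lemma flip_word s : flip (word s) = word (rev s).
Proof. exact: free_linearE. Qed.

Lemma flipK x : flip (flip x) = x.
Proof.
elim/free_ind: x => [|c x y IHx IHy|s]; first by rewrite !linear0.
  by rewrite !linearP IHx IHy.
by rewrite !flip_word revK.
Qed.

Lemma flipM x y : flip (x * y) = flip y * flip x.
Proof.
elim/free_ind: x => [|c x x' IHx IHx'|s]; first by rewrite mul0r linear0 mulr0.
  by rewrite mulrDl -scalerAl !linearP IHx IHx' mulrDr fa_scaleAr.
elim/free_ind: y => [|c y y' IHy IHy'|t]; first by rewrite mulr0 linear0 mul0r.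
  by rewrite mulrDr -fa_scaleAr !linearP IHy IHy' mulrDl scalerAl.
by rewrite wordM !flip_word wordM rev_cat.
Qed.

Lemma flip1 : flip 1 = 1.
Proof. by rewrite -word0 flip_word. Qed.

Lemma vacuum_coef_flip x : vacuum_coef (flip x) = vacuum_coef x.
Proof.
elim/free_ind: x => [|c x y IHx IHy|s]; first by rewrite !linear0.
  by rewrite !linearP IHx IHy.
by rewrite flip_word !vacuum_coef_word /nilp size_rev.
Qed.

Lemma vacuum_coef1 : vacuum_coef 1 = 1.
Proof. by rewrite -word0 vacuum_coef_word. Qed.

Lemma vacuum_coefM x y : vacuum_coef (x * y) = vacuum_coef x * vacuum_coef y.
Proof.
elim/free_ind: x => [|c x x' IHx IHx'|s]; first by rewrite !(mul0r, linear0).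
  by rewrite mulrDl -scalerAl !linearP IHx IHx' mulrDl -scalerAl.
elim/free_ind: y => [|c y y' IHy IHy'|t]; first by rewrite !(mulr0, linear0).
  by rewrite mulrDr -fa_scaleAr !linearP IHy IHy' mulrDr scalerAr.
by rewrite wordM !vacuum_coef_word; case: s t => [|? ?] [|? ?]; rewrite /= ?mulr0 ?mulr1.
Qed.

Lemma left_op_1 k : left_op k 1 = open_or_close [:: k].
Proof. by rewrite -word0 left_op_word /left_step addr0 word0 mulr1. Qed.

(** A left point only sees the first block of a row, so the operator commutes
    with right multiplications, except on the component of y along the empty
    row, where the first block is that of u. *)
Lemma left_op_mul k y u :
  left_op k (y * u) = left_op k y * u + vacuum_coef y *: (left_op k u - left_op k 1 * u).
Proof.
elim/free_ind: y => [|c y y' IHy IHy'|s].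
- by rewrite mul0r !linear0 mul0r scale0r addr0.
- rewrite mulrDl -scalerAl !linearP IHy IHy' mulrDl -scalerAl scalerDr scalerDl.
  by rewrite addrACA scalerA.
rewrite vacuum_coef_word; case: s => [|V s] /=.
  by rewrite word0 mul1r scale1r addrC subrK.
rewrite scale0r addr0; elim/free_ind: u => [|c u u' IHu IHu'|t].
- by rewrite !(mulr0, linear0).
- by rewrite !mulrDr -!fa_scaleAr linearP IHu IHu'.
rewrite wordM !left_op_word /left_step /= [RHS]mulrDl -[in RHS]mulrA wordM; congr (_ + _).
by case: ifP => _; rewrite ?mul0r // -[RHS]mulrA wordM.
Qed.

(** The Fock space of a single colour. Empty blocks are excluded, as they have
    every colour. *)
Inductive colored (d : bool) : F -> Prop :=
| colored0 : colored d 0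
| coloredD c x y : colored d x -> colored d y -> colored d (c *: x + y)
| colored_word s : all (fun V => (V != [::]) && all (fun a => col a == d) V) s ->
    colored d (word s).

Lemma colored1 d : colored d 1.
Proof. by rewrite -word0; exact: colored_word. Qed.

Lemma coloredDD d x y : colored d x -> colored d y -> colored d (x + y).
Proof. by move=> cx cy; rewrite -[x]scale1r; exact: coloredD. Qed.

Lemma coloredZ d c x : colored d x -> colored d (c *: x).
Proof. by move=> cx; rewrite -[_ *: _]addr0; apply: coloredD => //; exact: colored0. Qed.

Lemma colored_flip d x : colored d x -> colored d (flip x).
Proof.
elim=> [|c y z _ IHy _ IHz|s cs]; first by rewrite linear0; exact: colored0.
  by rewrite linearP; exact: coloredD.
by rewrite flip_word; apply: colored_word; rewrite all_rev.
Qed.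

Lemma open_or_close_word V s : open_or_close V * word s = word (V :: s) + f V *: word s.
Proof. by rewrite /open_or_close mulrDl wordM -scalerAl mul1r. Qed.

Lemma colored_left_op d k x : col k = d -> colored d x -> colored d (left_op k x).
Proof.
move=> kd; elim=> [|c y z _ IHy _ IHz|s cs]; first by rewrite linear0; exact: colored0.
  by rewrite linearP; exact: coloredD.
rewrite left_op_word /left_step; apply: coloredDD.
  rewrite open_or_close_word; apply: coloredDD.
    by apply: colored_word; rewrite /= kd eqxx.
  by apply: coloredZ; exact: colored_word.
case: s cs => [|V s] /=; first by move=> _; exact: colored0.
case/andP=> /andP[_ cV] cs; case: ifP => _; last exact: colored0.
rewrite open_or_close_word; apply: coloredDD.
  by apply: colored_word; rewrite /= kd eqxx /= cV.
by apply: coloredZ; exact: colored_word.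
Qed.

(** A point of another colour than the first block cannot join it. *)
Lemma left_op_foreign d k y u : col k != d -> colored d y ->
  left_op k (y * u) = left_op k 1 * (y * u) + vacuum_coef y *: (left_op k u - left_op k 1 * u).
Proof.
move=> kd; elim=> [|c {}y y' _ IHy _ IHy'|s cs].
- by rewrite mul0r !linear0 mulr0 scale0r addr0.
- rewrite mulrDl -scalerAl !linearP IHy IHy' mulrDr -fa_scaleAr scalerDr scalerDl.
  by rewrite addrACA scalerA.
rewrite vacuum_coef_word; case: s cs => [|V s] /=.
  by rewrite word0 mul1r scale1r addrC subrK.
case/andP=> /andP[nV cV] cs.
rewrite scale0r addr0; elim/free_ind: u => [|c u u' IHu IHu'|t].
- by rewrite !(mulr0, linear0).
- by rewrite !mulrDr -!fa_scaleAr linearP IHu IHu'.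
rewrite wordM left_op_word /left_step /= left_op_1.
case: V nV cV => //= a V _ /andP[/eqP ad _].
by rewrite /monochrome /= ad eq_sym (negbTE kd) addr0.
Qed.
End Fock.

(** * Moments in the Fock space *)

Section FockMoment.
Variables (K : fieldType) (L : choiceType) (col side : L -> bool).
Variable f : seq L -> K.
Variable F : free_algebra K (seq L).
Hypothesis f_monochrome : forall W, ~~ monochrome col W -> f W = 0.
Variables (n : nat) (x : 'I_n -> L).

(** A new point is smaller than all others, whichever side it is on, and so goes in
    front of the word of its block. *)
Definition block_word (V : {set 'I_n}) : seq L := [seq x i | i <- enum V].

(** Diagrams with a block of two colours are sent to 0, so that the sums below
    can run over all diagrams whatever the colours. *)
Definition mono_word (W : seq L) : F := if monochrome col W then word [:: W] else 0.
Definition mono_open_or_close (W : seq L) : F :=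
  if monochrome col W then open_or_close f F W else 0.

Lemma mono_open_or_closeE W : mono_open_or_close W = mono_word W + f W *: 1.
Proof.
rewrite /mono_open_or_close /mono_word; case: ifP => [//|/negbT/f_monochrome->].
by rewrite scale0r addr0.
Qed.

Definition stack_vec (t : seq {set 'I_n}) : F := \prod_(V <- t) mono_word (block_word V).

Lemma stack_vecE t : stack_vec t =
  if all (monochrome col) (map block_word t) then word (map block_word t) else 0.
Proof.
elim: t => [|V t IH]; first by rewrite /stack_vec big_nil /= word0.
rewrite /stack_vec big_cons -/(stack_vec t) IH /= /mono_word.
by case: (monochrome _ _); case: (all _ _); rewrite /= ?mul0r ?mulr0 // wordM.
Qed.

Lemma monochrome_behead k W : monochrome col (k :: W) -> monochrome col W.
Proof.
by rewrite /monochrome /=; case: W => //= a W /andP[/eqP->].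
Qed.

Lemma left_op_stack k t : left_op col f F k (stack_vec t) =
  mono_open_or_close [:: k] * stack_vec t +
  (if t is V :: t' then mono_open_or_close (k :: block_word V) * stack_vec t' else 0).
Proof.
have mk : monochrome col [:: k] by [].
rewrite {1}/mono_open_or_close mk !stack_vecE; case: ifP => [mt|nmt].
  rewrite left_op_word /left_step; congr (_ + _); case: t mt => //= V t /andP[_ mt].
  rewrite stack_vecE mt /mono_open_or_close; case: ifP => //; by rewrite mul0r.
rewrite linear0 mulr0 add0r; case: t nmt => //= V t /negbT.
rewrite negb_and stack_vecE /mono_open_or_close => /orP[nV|/negbTE->]; last by rewrite mulr0.
by case: ifP => [/monochrome_behead|]; [rewrite (negbTE nV)|rewrite mul0r].
Qed.

Definition diagram_vec (st : diagram 'I_n) : F :=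
  (\prod_(V in st.1) f (block_word V)) *: stack_vec st.2.

Lemma block_word_insert (k : 'I_n) (V : {set 'I_n}) : (forall i, i \in V -> (k < i)%N) ->
  block_word (k |: V) = x k :: block_word V.
Proof.
move=> kV; rewrite /block_word -map_cons; congr map.
have tr : transitive (fun a b : 'I_n => a < b)%N by move=> ? ? ?; exact: ltn_trans.
apply: (irr_sorted_eq tr) => [a||| i]; first by rewrite ltnn.
- exact: enum_ord_sorted.
- rewrite /= path_sortedE // enum_ord_sorted andbT; apply/allP => i.
  by rewrite mem_enum => /kV.
- by rewrite mem_enum !inE mem_enum.
Qed.

Lemma left_op_diagram (k : 'I_n) st :
  (forall (V : {set 'I_n}) i, has_block st V -> i \in V -> (k < i)%N) ->
  left_op col f F (x k) (diagram_vec st) = \sum_(st' <- insertions k st) diagram_vec st'.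
Proof.
case: st => C t kst; rewrite /diagram_vec linearZ /= left_op_stack.
rewrite /insertions big_flatten big_map /=.
have two (V : {set 'I_n}) (t' : seq {set 'I_n}) : (forall i, i \in V -> (k < i)%N) ->
    \sum_(st' <- [:: (C, (k |: V) :: t') : diagram 'I_n; ((k |: V) |: C, t')])
      (\prod_(U in st'.1) f (block_word U)) *: stack_vec st'.2 =
    (\prod_(U in C) f (block_word U)) *:
      (mono_open_or_close (x k :: block_word V) * stack_vec t').
  move=> kV; rewrite big_cons big_seq1 /= big_setU1 /=; last first.
    apply/negP => VC; have := kst (k |: V) k; rewrite setU11 ltnn.
    by rewrite /has_block /= VC => /(_ isT isT).
  rewrite /stack_vec big_cons -/(stack_vec t') block_word_insert // mono_open_or_closeE.
  by rewrite mulrDl scalerDr -scalerAl mul1r scalerA mulrC.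
have e0 : block_word set0 = [::] by rewrite /block_word enum_set0.
rewrite big_cons two; last by move=> i; rewrite inE.
rewrite e0; case: t kst two => [|V t] kst two; first by rewrite big_nil !addr0.
rewrite big_seq1 two ?scalerDr // => i iV.
by apply: kst iV; rewrite /has_block /= inE eqxx orbT.
Qed.

Lemma flip_diagram st : flip F (diagram_vec st) = diagram_vec (mirror st).
Proof.
case: st => C t; rewrite /diagram_vec linearZ; congr (_ *: _) => /=.
elim: t => [|V t IH]; first by rewrite /stack_vec big_nil flip1.
rewrite /stack_vec big_cons flipM [X in X * _]IH rev_cons -cats1 big_cat big_seq1.
congr (_ * _); rewrite /mono_word; case: ifP => _; last exact: linear0.
by rewrite flip_word.
Qed.

Lemma fock_op_diagram (k : 'I_n) st :
  (forall (V : {set 'I_n}) i, has_block st V -> i \in V -> (k < i)%N) ->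
  fock_op col side f F (x k) (diagram_vec st) =
  \sum_(st' <- insert_point (side \o x) k st) diagram_vec st'.
Proof.
move=> kst; rewrite /fock_op /insert_point -[(side \o x) k]/(side (x k)).
case: (side _); first exact: left_op_diagram.
rewrite -[LHS]/(flip F (left_op col f F (x k) (flip F (diagram_vec st)))).
rewrite flip_diagram left_op_diagram; last first.
  by move=> V i; rewrite /has_block /= mem_rev; exact: kst.
by rewrite linear_sum big_map; apply: eq_bigr => st' _; exact: flip_diagram.
Qed.

(** A diagram remembers the insertions that led to it, so the expansion of the
    product has one term for each diagram. *)
Lemma fock_op_diagrams s : pairwise (fun a b : 'I_n => a < b)%N s ->
  foldr (fun k => fock_op col side f F (x k)) 1 s =
  \sum_(st <- diagrams (side \o x) s) diagram_vec st.
Proof.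
elim: s => [|k s IH] /= => [_|/andP[/allP ks srt]].
  by rewrite big_seq1 /diagram_vec big_set0 /stack_vec big_nil scale1r.
rewrite IH // linear_sum big_flatten big_map !big_seq; apply: eq_bigr => st std.
have [_ /(_ st)[/(_ std) vs _]] := diagramsP (side \o x) srt.
apply: fock_op_diagram => V i bV iV; have [_ /subsetP/(_ i iV)] := valid_sub vs bV.
by rewrite inE => /ks.
Qed.

Lemma vacuum_coef_diagram st :
  vacuum_coef F (diagram_vec st) = if nilp st.2 then \prod_(V in st.1) f (block_word V) else 0.
Proof.
case: st => C [|V t]; rewrite /diagram_vec linearZ /= /stack_vec.
  by rewrite big_nil vacuum_coef1 [LHS]mulr1.
rewrite big_cons vacuum_coefM /mono_word.
case: ifP => _; last by rewrite linear0 mul0r scaler0.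
by rewrite vacuum_coef_word mul0r scaler0.
Qed.

(** The vacuum coefficient keeps the histories that close all their blocks. *)
Theorem fock_moment :
  vacuum_coef F (foldr (fun k => fock_op col side f F (x k)) 1 (enum 'I_n)) =
  \sum_(pi in BNC (side \o x)) \prod_(V in pi) f (block_word V).
Proof.
have srt : pairwise (fun a b : 'I_n => a < b)%N (enum 'I_n).
  rewrite -sorted_pairwise; last by move=> ? ? ?; exact: ltn_trans.
  exact: enum_ord_sorted.
rewrite fock_op_diagrams // linear_sum; have [un mem] := diagramsP (side \o x) srt.
under eq_bigr do rewrite vacuum_coef_diagram.
rewrite -big_mkcond -big_filter.
rewrite -(big_map fst xpredT
  (fun C : {set {set 'I_n}} => \prod_(V in C) f (block_word V))) /=.
have nil (st : diagram 'I_n) : nilp st.2 -> st = (st.1, [::]).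
  by case: st => C [].
rewrite big_uniq; last first.
  rewrite map_inj_in_uniq ?filter_uniq // => st st'; rewrite !mem_filter.
  by move=> /andP[/nil -> _] /andP[/nil -> _] /= ->.
apply: eq_bigl => C; apply/idP/idP => [/mapP[st]|CB].
  rewrite mem_filter => /andP[/nil e /mem vs] ->; apply/mem_BNC.
  by move: vs; rewrite {1}e; congr valid; apply/setP => i; rewrite !inE mem_enum.
apply/mapP; exists (C, [::]) => //; rewrite mem_filter /=; apply/mem.
have -> : [set i in enum 'I_n] = setT by apply/setP => i; rewrite !inE mem_enum.
by apply/mem_BNC.
Qed.
End FockMoment.

(** * Comparing the free product with the Fock space *)

Section FreeProductAction.
Variables (K : fieldType) (X : bool -> pspace K).

Local Notation dj := (dinj alternating (word_space X)).

(** The four lemmas below describe the representations on a tensor: an operator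
    of the colour d acts on the extreme factor if that factor has colour d, and
    on a state-vector inserted there otherwise. *)
Lemma lrep_lword d (T : Lop (X d)) w t : lword d w ->
  (lrep T : {linear fprod X -> fprod X}) (dj w t) =
  pcoef (X d) ((T : {linear X d -> X d}) (pvec (X d))) *: dj w t
  + dj (d :: w) (tens (pcomp (X d) ((T : {linear X d -> X d}) (pvec (X d)))) t).
Proof.
move=> lw; have := VmapE (pvec (X d)) t lw.
rewrite pcoef_vec scale1r pcomp_vec -[tens 0 t]/(tensl _ t 0) !linear0 addr0.
move=> e; rewrite -{1}e {e}.
by rewrite lrepE tmapE VmapE.
Qed.

Lemma lrep_cons d (T : Lop (X d)) w (x : pker (X d)) t : lword d w ->
  (lrep T : {linear fprod X -> fprod X}) (dj (d :: w) (tens x t)) =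
  pcoef (X d) ((T : {linear X d -> X d}) (val x)) *: dj w t
  + dj (d :: w) (tens (pcomp (X d) ((T : {linear X d -> X d}) (val x))) t).
Proof.
move=> lw; have := VmapE (val x) t lw.
rewrite pcoef_ker scale0r add0r pcomp_ker => e; rewrite -{1}e {e}.
by rewrite lrepE tmapE VmapE.
Qed.

Lemma rrep_rword d (T : Lop (X d)) w t : rword d w ->
  (rrep T : {linear fprod X -> fprod X}) (dj w t) =
  pcoef (X d) ((T : {linear X d -> X d}) (pvec (X d))) *: dj w t
  + dj (rcons w d) (tcat (pcomp (X d) ((T : {linear X d -> X d}) (pvec (X d)))) w t).
Proof.
move=> rw; have := WmapE (pvec (X d)) t rw.
rewrite pcoef_vec scale1r pcomp_vec.
have -> : tcat (0 : pker (X d)) w t = 0.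
  exact: (linear0 (mklin (@tcat_linear _ _ d w t))).
rewrite linear0 addr0 => e; rewrite -{1}e {e}.
by rewrite rrepE tmapE WmapE.
Qed.

Lemma rrep_rcons d (T : Lop (X d)) w (x : pker (X d)) t : rword d w ->
  (rrep T : {linear fprod X -> fprod X}) (dj (rcons w d) (tcat x w t)) =
  pcoef (X d) ((T : {linear X d -> X d}) (val x)) *: dj w t
  + dj (rcons w d) (tcat (pcomp (X d) ((T : {linear X d -> X d}) (val x))) w t).
Proof.
move=> rw; have := WmapE (val x) t rw.
rewrite pcoef_ker scale0r add0r pcomp_ker => e; rewrite -{1}e {e}.
by rewrite rrepE tmapE WmapE.
Qed.

Variables (Idx : choiceType) (side : bool * Idx -> bool).
Variable T : forall d, Idx -> Lop (X d).
Variable f : seq (bool * Idx) -> K.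
Variable F : free_algebra K (seq (bool * Idx)).

Let act d (x : X d) (w : seq Idx) : X d :=
  foldr (fun i v => (T d i : {linear X d -> X d}) v) x w.
Local Notation fock_op := (fock_op (@fst bool Idx) side f F).
Let fock_act d (y : F) (w : seq Idx) : F := foldr (fun i v => fock_op (d, i) v) y w.
Local Notation colored := (colored (@fst bool Idx)).

(** No product of operators of the colour d tells a vector from its twin. In
    general no linear map from X d sends vectors to twins: different products of
    operators may agree at the state-vector of X d but not at the vacuum. *)
Definition twin d (x : X d) (y : F) : Prop :=
  colored d y /\ forall w, pcoef (X d) (act x w) = vacuum_coef F (fock_act d y w).

Lemma act_linear d c (x x' : X d) w : act (c *: x + x') w = c *: act x w + act x' w.
Proof. by elim: w => //= i w ->; rewrite linearP. Qed.

Lemma fock_act_linear d c (x x' : F) w :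
  fock_act d (c *: x + x') w = c *: fock_act d x w + fock_act d x' w.
Proof. by elim: w => //= i w ->; rewrite linearP. Qed.

Lemma twin_linear d c (x x' : X d) y y' :
  twin x y -> twin x' y' -> twin (c *: x + x') (c *: y + y').
Proof.
move=> [cy m] [cy' m']; split; first exact: coloredD.
by move=> w; rewrite act_linear fock_act_linear !linearP m m'.
Qed.

Lemma twin_op d i (x : X d) y :
  twin x y -> twin ((T d i : {linear X d -> X d}) x) (fock_op (d, i) y).
Proof.
move=> [cy m]; split.
  rewrite /fock_op; case: (side _); first exact: colored_left_op.
  by apply: colored_flip; apply: colored_left_op => //; exact: colored_flip.
by move=> w; have := m (rcons w i); rewrite /act /fock_act !foldr_rcons.
Qed.

Lemma twin_coef d (x : X d) y : twin x y -> pcoef (X d) x = vacuum_coef F y.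
Proof. by case=> _ /(_ [::]). Qed.

Hypothesis twin1 : forall d, twin (pvec (X d)) 1.

Lemma twin_comp d (x : X d) y : twin x y ->
  twin (val (pcomp (X d) x)) (y - vacuum_coef F y *: 1).
Proof.
move=> xy; rewrite pcompE pcoefE (twin_coef xy) addrC -scaleNr [y - _]addrC -scaleNr.
exact: twin_linear.
Qed.

Fixpoint twin_word w : word_space X w -> F -> Prop :=
  match w with
  | [::] => fun t u => t = 1 /\ u = 1
  | d :: w' => fun t u => exists x y t' u',
     [/\ twin (val (x : pker (X d))) y, @twin_word w' t' u', t = tens x t' & u = y * u']
  end.

(** Words are built from the left; right representations need the last factor. *)
Lemma twin_word_rcons d w (t : word_space X (rcons w d)) u :
  twin_word t u <-> exists x y t' u',
     [/\ twin (val (x : pker (X d))) y, @twin_word w t' u', t = tcat x w t' & u = u' * y].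
Proof.
elim: w t u => [|d' w IH] t u.
  split=> [[x [y [t' [u' [xy [-> ->] -> ->]]]]]|[x [y [t' [u' [xy [-> ->] -> ->]]]]]].
    by exists x, y, 1, 1; split; rewrite ?mulr1 ?mul1r.
  by exists x, y, 1, 1; split; rewrite ?mulr1 ?mul1r.
split=> [[x [y [t' [u' [xy /IH tu -> ->]]]]]|].
  case: tu => z [v [t'' [u'' [zv tu -> ->]]]].
  exists z, v, (tens x t''), (y * u''); split=> //; last by rewrite mulrA.
    by exists x, y, t'', u''.
  by rewrite tcat_cons.
move=> [z [v [t'' [u'' [zv [x [y [t' [u' [xy tu -> ->]]]]] -> ->]]]]].
exists x, y, (tcat z w t'), (u' * v); split=> //; last by rewrite mulrA.
  by apply/IH; exists z, v, t', u'.
by rewrite tcat_cons.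
Qed.

(** A relation rather than a map, since a vector can have several twins. *)
Inductive related : fprod X -> F -> Prop :=
| related0 : related 0 0
| relatedD c v v' u u' : related v u -> related v' u' -> related (c *: v + v') (c *: u + u')
| related_word w t u : alternating w -> @twin_word w t u -> related (dj w t) u.

Lemma related_coef v u : related v u -> pcoef (fprod X) v = vacuum_coef F u.
Proof.
elim=> [|c {}v v' {}u u' _ IH _ IH'|w t {}u aw tu]; first by rewrite !linear0.
  by rewrite !linearP IH IH'.
case: w t aw tu => [|d w] t aw.
  by case=> -> ->; rewrite vacuum_coef1; exact: (pcoef_vec (fprod X)).
case=> x [y [t' [u' [xy tu -> ->]]]].
have -> : pcoef (fprod X) (dj (d :: w) (tens x t')) = 0.
  apply: pcoef_uniq; rewrite scale0r.
  rewrite -[LHS]/(dj [::] (dj (d :: w) (tens x t') [::])).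
  by rewrite dinj_neq // linear0.
have vy : vacuum_coef F y = 0 by rewrite -(twin_coef xy) pcoef_ker.
by rewrite vacuum_coefM vy mul0r.
Qed.

Local Notation left_op := (left_op (@fst bool Idx) f F).

Lemma twin_coef0 d (x : pker (X d)) y : twin (val x) y -> vacuum_coef F y = 0.
Proof. by move=> /twin_coef <-; rewrite pcoef_ker. Qed.

(** Decomposing a vector and its twin into the scalar and the centred part
    shortens the tensor or changes its first factor, on both sides alike. *)
Lemma related_lnat d (x : X d) y w t u : lword d w -> twin x y -> @twin_word w t u ->
  related (pcoef (X d) x *: dj w t + dj (d :: w) (tens (pcomp (X d) x) t)) (y * u).
Proof.
move=> lw xy tu; rewrite (twin_coef xy).
have -> : y * u = vacuum_coef F y *: u + (y - vacuum_coef F y *: 1) * u.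
  by rewrite mulrBl -scalerAl mul1r addrC subrK.
apply: relatedD; first by apply: related_word => //; exact: lword_alt lw.
apply: related_word; first by rewrite alt_cons.
by exists (pcomp (X d) x), (y - vacuum_coef F y *: 1), t, u; split=> //; exact: twin_comp.
Qed.

Lemma related_rnat d (x : X d) y w t u : rword d w -> twin x y -> @twin_word w t u ->
  related (pcoef (X d) x *: dj w t + dj (rcons w d) (tcat (pcomp (X d) x) w t)) (u * y).
Proof.
move=> rw xy tu; rewrite (twin_coef xy).
have -> : u * y = vacuum_coef F y *: u + u * (y - vacuum_coef F y *: 1).
  by rewrite mulrBr -fa_scaleAr mulr1 addrC subrK.
apply: relatedD; first by apply: related_word => //; exact: rword_alt rw.
apply: related_word; first by rewrite alt_rcons.
apply/twin_word_rcons.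
by exists (pcomp (X d) x), (y - vacuum_coef F y *: 1), t, u; split=> //; exact: twin_comp.
Qed.

Definition rep_op (a : bool * Idx) : Lop (fprod X) :=
  if side a then lrep (T a.1 a.2) else rrep (T a.1 a.2).

(** In each case an operator replaces the extreme factor, possibly an inserted
    vacuum, and its twin by images that are twins again. *)
Lemma related_rep_op a v u : related v u ->
  related ((rep_op a : {linear fprod X -> fprod X}) v) (fock_op a u).
Proof.
elim=> [|c {}v v' {}u u' _ IH _ IH'|w t {}u aw tu].
- by rewrite !linear0; exact: related0.
- by rewrite !linearP; exact: relatedD.
case: a => d i; have t1 := twin_op i (twin1 d); move: t1; rewrite /rep_op /fock_op /=.
case: (boolP (side (d, i))) => sa t1.
- have [lw|nlw] := boolP (lword d w).
    rewrite lrep_lword //.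
    have -> : left_op (d, i) u = left_op (d, i) 1 * u.
      case: w t aw lw tu => [|d' w] t aw lw; first by case=> _ ->; rewrite mulr1.
      case=> x [y [t' [u' [xy tu _ ->]]]].
      rewrite [LHS](@left_op_foreign _ _ _ _ _ d') ?(twin_coef0 xy) ?scale0r ?addr0 //;
        last by case: xy.
      by case/andP: lw => _ /=; rewrite eq_sym.
    exact: related_lnat.
  case: w t aw nlw tu => [|d' w] t aw nlw.
    by case/negP: nlw; rewrite /lword; case: (d).
  have ed : d' = d by move: nlw; rewrite /lword aw /= negbK => /eqP.
  move: ed t aw {nlw} => -> t; rewrite alt_cons => lw.
  case=> x [y [t' [u' [xy tu -> ->]]]].
  rewrite lrep_cons // [X in related _ X]left_op_mul (twin_coef0 xy) scale0r addr0.
  apply: related_lnat => //.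
  by have := twin_op i xy; rewrite /fock_op sa.
have [rw|nrw] := boolP (rword d w).
  rewrite rrep_rword //.
  rewrite -[X in related _ X]/(flip F (left_op (d, i) (flip F u))).
  have -> : flip F (left_op (d, i) (flip F u)) = u * flip F (left_op (d, i) (flip F 1)).
    case/lastP: w t aw rw tu => [|w d'] t aw rw; first by case=> _ ->; rewrite mul1r.
    case/twin_word_rcons=> x [y [t' [u' [xy tu _ ->]]]].
    rewrite flipM [left_op _ _](@left_op_foreign _ _ _ _ _ d') ?vacuum_coef_flip
      ?(twin_coef0 xy) ?scale0r ?addr0 //.
    + by rewrite !flipM !flipK flip1.
    + by case/andP: rw => _; rewrite last_rcons eq_sym.
    + by apply: colored_flip; case: xy.
  exact: related_rnat.
case/lastP: w t aw nrw tu => [|w d'] t aw nrw.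
  by case/negP: nrw; rewrite /rword; case: (d).
have ed : d' = d by move: nrw; rewrite /rword aw last_rcons negbK => /eqP.
move: ed t aw {nrw} => -> t; rewrite alt_rcons => rw.
case/twin_word_rcons=> x [y [t' [u' [xy tu -> ->]]]].
rewrite rrep_rcons // -[X in related _ X]/(flip F (left_op (d, i) (flip F (u' * y)))) flipM.
have -> : left_op (d, i) (flip F y * flip F u') = left_op (d, i) (flip F y) * flip F u'.
  by rewrite [LHS]left_op_mul vacuum_coef_flip (twin_coef0 xy) scale0r addr0.
rewrite flipM flipK; apply: related_rnat => //.
by have := twin_op i xy; rewrite /fock_op (negbTE sa).
Qed.

Lemma Lop_prod (Y : pspace K) (S : eqType) (g : S -> Lop Y) (s : seq S) v :
  ((\prod_(k <- s) g k : Lop Y) : {linear Y -> Y}) v =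
  foldr (fun k x => (g k : {linear Y -> Y}) x) v s.
Proof. by elim: s v => [|k s IH] v; rewrite ?big_nil ?big_cons //= -IH. Qed.

Theorem free_product_moment (s : seq (bool * Idx)) :
  pstate (\prod_(a <- s) rep_op a) = vacuum_coef F (foldr (fun a => fock_op a) 1 s).
Proof.
rewrite /pstate Lop_prod; apply: related_coef.
elim: s => [|a s IH] /=; last exact: related_rep_op.
by apply: (@related_word [::] (1 : K^o)).
Qed.
End FreeProductAction.

(** * Cumulants along words *)

Section Cumulants.
Variables (K : fieldType) (A : ncspace K) (S : choiceType).
Variables (side : S -> bool) (z : S -> A).

Definition word_kappa (W : seq S) : K :=
  kappa (fun i => side (tnth (in_tuple W) i)) (fun i => z (tnth (in_tuple W) i)).

Lemma word_kappaE n (x : 'I_n -> S) :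
  word_kappa [seq x i | i <- enum 'I_n] = kappa (side \o x) (z \o x).
Proof.
rewrite /word_kappa; set W := map x _; have e : size W = n by rewrite size_map size_enum_ord.
have xE i : tnth (in_tuple W) i = x (cast_ord e i).
  rewrite (tnth_nth (x (cast_ord e i))) /= (nth_map (cast_ord e i)).
    by congr x; apply: val_inj; rewrite /= nth_enum_ord // -[X in (_ < X)%N]e.
  by rewrite size_enum_ord -[X in (_ < X)%N]e.
have -> : (fun i => side (tnth (in_tuple W) i)) = side \o (x \o cast_ord e).
  by apply: funext => i; rewrite xE.
have -> : (fun i => z (tnth (in_tuple W) i)) = z \o (x \o cast_ord e).
  by apply: funext => i; rewrite xE.
case: _ / (esym e) (e) => e'.
by congr kappa; apply: funext => i /=; rewrite cast_ord_id.
Qed.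

Lemma block_word_map n (x : 'I_n -> S) (V : {set 'I_n}) :
  block_word x V = [seq restr V x t | t <- enum 'I_#|V|].
Proof.
rewrite /block_word /restr (map_comp x enum_val); congr map.
case: (set_0Vmem V) => [->|[v vV]].
  by rewrite enum_set0; apply/esym/eqP; rewrite -size_eq0 size_map size_enum_ord cards0.
apply: (@eq_from_nth _ v) => [|i]; first by rewrite size_map size_enum_ord cardE.
rewrite -cardE => iV; rewrite (nth_map (Ordinal iV)) ?size_enum_ord //.
by rewrite (enum_val_nth v) nth_enum_ord.
Qed.

Lemma word_kappa_block n (x : 'I_n -> S) (V : {set 'I_n}) :
  word_kappa (block_word x V) = kappa (restr V (side \o x)) (restr V (z \o x)).
Proof. by rewrite block_word_map word_kappaE. Qed.

Lemma block_wordT n (x : 'I_n -> S) : block_word x setT = [seq x i | i <- enum 'I_n].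
Proof. by rewrite /block_word enum_setT enumT. Qed.

(** The moment-cumulant formula on the words in the elements z s alone already
    determines the cumulants of these words, by induction on their length. *)
Lemma kappa_unique_word (g : seq S -> K) :
  (forall n (x : 'I_n -> S), (0 < n)%N -> nc_state A (\prod_(i < n) z (x i)) =
     \sum_(pi in BNC (side \o x)) \prod_(V in pi) g (block_word x V)) ->
  forall n (x : 'I_n -> S), (0 < n)%N ->
    g [seq x i | i <- enum 'I_n] = kappa (side \o x) (z \o x).
Proof.
move=> gP n; have [N] := ubnP n; elim: N n => // N IH n nN x n0.
have := gP n x n0; rewrite (moment_cumulant (side \o x) (z \o x) n0).
rewrite (bigD1 [set [set: 'I_n]]) ?BNC_setT //= big_set1 (restr_setT (@kappa K A)).
rewrite [RHS](bigD1 [set [set: 'I_n]]) ?BNC_setT //= big_set1 block_wordT.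
under [X in _ = _ + X]eq_bigr => pi /andP[piB npi].
  under eq_bigr => V Vpi.
    have /andP[V0 Vn] := block_lt piB npi Vpi.
    rewrite block_word_map IH //; last exact: leq_trans Vn _.
    over.
  over.
by move=> /addIr->.
Qed.
End Cumulants.

(** * The moment formula for the free product *)

Section MomentFormula.
Variables (K : fieldType) (X : bool -> pspace K) (Idx : choiceType).
Variables (side : bool * Idx -> bool) (T : forall d, Idx -> Lop (X d)).
Variable f : seq (bool * Idx) -> K.
Hypothesis f_monochrome : forall W, ~~ monochrome (@fst bool Idx) W -> f W = 0.
Hypothesis f_moments : forall d n (y : 'I_n -> Idx), (0 < n)%N ->
  pstate (\prod_(i < n) T d (y i)) =
  \sum_(pi in BNC (fun i => side (d, y i)))
    \prod_(V in pi) f (block_word (fun i => (d, y i)) V).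

Let F := monoid_algebra K (seq (bool * Idx)).

Lemma foldr_ord (R S : Type) (h : S -> R -> R) (r : R) n (x : 'I_n -> S) :
  foldr (fun i => h (x i)) r (enum 'I_n) = foldr h r [seq x i | i <- enum 'I_n].
Proof. by elim: (enum 'I_n) => //= i s ->. Qed.

Lemma prod_enum_ord (R : pzSemiRingType) n (h : 'I_n -> R) :
  \prod_(i < n) h i = \prod_(i <- enum 'I_n) h i.
Proof. by rewrite [index_enum _]unlock -enumT. Qed.

Lemma prod_map_ord (R : pzSemiRingType) (S : Type) n (x : 'I_n -> S) (h : S -> R) :
  \prod_(a <- [seq x i | i <- enum 'I_n]) h a = \prod_(i < n) h (x i).
Proof. by rewrite big_map prod_enum_ord. Qed.

(** In one colour, the moments of X d and those of the Fock space are given by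
    the same sum over bi-non-crossing partitions. *)
Lemma twin_vacuum d : twin side T f (F := F) (pvec (X d)) 1.
Proof.
split=> [|w]; first exact: colored1.
case: w => [|i0 w]; first by rewrite [RHS]vacuum_coef1; exact: pcoef_vec.
set s := i0 :: w; pose y := tnth (in_tuple s).
have := f_moments d y isT.
have <- := fock_moment side F f_monochrome (fun i => (d, y i)).
rewrite prod_enum_ord /pstate Lop_prod.
rewrite (foldr_ord (fun i v => (T d i : {linear X d -> X d}) v) _ y).
by rewrite (foldr_ord (fun i v => fock_op (@fst bool Idx) side f F (d, i) v) 1 y) map_tnth_enum.
Qed.

(** The origin of the weights does not matter, as long as they give the right
    moments on each space separately and mixed blocks count for 0. *)
Theorem moment_formula n (x : 'I_n -> bool * Idx) :
  pstate (\prod_(i < n) rep_op side T (x i)) =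
  \sum_(pi in BNC (side \o x)) \prod_(V in pi) f (block_word x V).
Proof.
rewrite -(fock_moment side F f_monochrome x).
have := free_product_moment twin_vacuum [seq x i | i <- enum 'I_n].
rewrite big_map -prod_enum_ord => ->.
by rewrite (foldr_ord (fun a v => fock_op (@fst bool Idx) side f F a v) 1 x).
Qed.
End MomentFormula.

(** * Bi-freeness and the vanishing of mixed cumulants *)

Section BiFreeness.
Variables (K : fieldType) (A : ncspace K) (I J : choiceType) (z' z'' : two_faced A I J).

Let letter := (bool * (I + J))%type.
Let side (a : letter) : bool := is_inl a.2.
Let z (a : letter) : A := fam z' z'' a.1 a.2.

Lemma pstate_linear (X : pspace K) : scalar (@pstate K X).
Proof. by move=> c S T; rewrite /pstate -linearP. Qed.

Lemma pstate1 (X : pspace K) : pstate (1 : Lop X) = 1.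
Proof. exact: pcoef_vec. Qed.

(** Cumulants of operators are taken in the algebra of all operators, with the
    vacuum state. *)
Definition Lop_space (X : pspace K) : ncspace K :=
  @NCSpace K (Lop X)
    (HB.pack (@pstate K X) (GRing.isLinear.Build K (Lop X) K *%R _ (@pstate_linear X)))
    (pstate1 X).

Lemma monochrome_block n (x : 'I_n -> letter) (V : {set 'I_n}) d : (forall i, (x i).1 = d) ->
  monochrome fst (block_word x V).
Proof.
move=> xd; rewrite /monochrome /block_word -map_comp; case: (enum V) => //= i s.
by rewrite xd; apply/allP => _ /mapP[j _ ->]; rewrite /= xd.
Qed.

(** The weights are the cumulants of the operators on each space; the uniqueness
    of cumulants identifies them with the cumulants of the two families. *)
Lemma bi_free_comb : bi_free z' z'' -> comb_bi_free z' z''.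
Proof.
case=> X [l [r XP]] n alpha chi eps n0 chiP neps.
pose T d (k : I + J) : Lop (X d) :=
  match k with inl i => l d (ncvar K i) | inr j => r d (ncvar K j) end.
(* the first letter of a word of one colour says on which space it acts *)
pose f (W : seq letter) : K :=
  if monochrome fst W then
    (if W is a :: _ then
       word_kappa (A := Lop_space (X a.1)) side (fun b => T a.1 b.2) W else 0)
  else 0.
have f_monochrome W : ~~ monochrome fst W -> f W = 0 by rewrite /f => /negbTE->.
have repE (a : letter) : rep_op side T a = rep_family l r a.1 a.2.
  by case: a => d [i|j].
have f_moments d m (y : 'I_m -> I + J) : (0 < m)%N ->
    pstate (\prod_(i < m) T d (y i)) = \sum_(pi in BNC (fun i => side (d, y i)))
      \prod_(V in pi) f (block_word (fun i => (d, y i)) V).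
  move=> m0; rewrite -[LHS]/(nc_state (Lop_space (X d)) (\prod_(i < m) T d (y i))).
  rewrite (moment_cumulant (fun i => side (d, y i)) _ m0); apply: eq_bigr => pi piB.
  apply: eq_bigr => V Vpi; rewrite /f (@monochrome_block _ _ _ d) //.
  have V0 : V != set0.
    by move: piB; rewrite inE => /andP[/and3P[_ _ +] _]; apply: contraNneq => <-.
  have := word_kappa_block (A := Lop_space (X d)) side (fun b => T d b.2) (fun i => (d, y i)) V.
  have : enum V != [::] by rewrite -size_eq0 -cardE cards_eq0.
  by rewrite /block_word; case: (enum V) => //= i s _ ->.
have gP m (x : 'I_m -> letter) : (0 < m)%N -> nc_state A (\prod_(i < m) z (x i)) =
    \sum_(pi in BNC (side \o x)) \prod_(V in pi) f (block_word x V).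
  move=> m0; rewrite -(moment_formula f_monochrome f_moments).
  have := XP [seq x i | i <- enum 'I_m]; rewrite !prod_map_ord => <-.
  by congr pstate; apply: eq_bigr => i _; rewrite repE.
pose x t : letter := (eps t, alpha t).
have := kappa_unique_word gP x n0.
have -> : side \o x = chi by apply: funext => t; exact: chiP.
move=> <-; rewrite f_monochrome //; apply/negP => mx; apply: neps.
exists (eps (Ordinal n0)) => t.
have cst (s : seq 'I_n) i j :
    constant [seq eps i | i <- s] -> i \in s -> j \in s -> eps i = eps j.
  case: s => //= a s; rewrite all_map => /allP /= h.
  have {}h k : k \in a :: s -> eps k = eps a by rewrite inE => /orP[/eqP->//|/h/eqP].
  by move=> /h -> /h ->.
apply: (cst (enum 'I_n)); rewrite ?mem_enum //.
by move: mx; rewrite /monochrome -map_comp.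
Qed.

(** The algebra itself as a space with state-vector 1. *)
Definition alg_proj_fun (a : A) : A := nc_state A a *: 1.
Lemma alg_proj_linear : linear alg_proj_fun.
Proof. by move=> c x y; rewrite /alg_proj_fun linearP scalerDl -scalerA. Qed.
Lemma alg_proj_vec : mklin alg_proj_linear 1 = 1.
Proof. by rewrite /= /alg_proj_fun nc_state1 scale1r. Qed.
Lemma alg_proj_line x : exists c, mklin alg_proj_linear x = c *: 1.
Proof. by exists (nc_state A x). Qed.

Definition alg_space : pspace K := PSpace (oner_neq0 A) alg_proj_vec alg_proj_line.

Lemma mull_linear (a : A) : linear (fun x : A => a * x).
Proof. by move=> c x y; rewrite mulrDr scalerAr. Qed.
Definition lmul (a : A) : Lop alg_space := mklin (mull_linear a).

Lemma pstate_lmul n (a : 'I_n -> A) :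
  pstate (\prod_(i < n) lmul (a i)) = nc_state A (\prod_(i < n) a i).
Proof.
have -> : \prod_(i < n) lmul (a i) = lmul (\prod_(i < n) a i).
  apply: (big_ind2 (fun (S : Lop alg_space) b => S = lmul b)) => [|_ x _ y -> ->|//].
    by apply: linear_eq => v /=; rewrite mul1r.
  by apply: linear_eq => v /=; rewrite mulrA.
by apply: pcoef_uniq; rewrite /= mulr1.
Qed.

Lemma lmul_hom (S : choiceType) (g : S -> A) :
  exists l : {lrmorphism ncpoly K S -> Lop alg_space},
    forall s, l (ncvar K s) = lmul (g s).
Proof.
have [phi phiM phiE] := free_algebra_morph (monoid_algebra K S) (fun s => lmul (g s)).
pose l : {lrmorphism ncpoly K S -> Lop alg_space} :=
  HB.pack (phi : ncpoly K S -> Lop alg_space)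
    (GRing.isMonoidMorphism.Build (ncpoly K S) (Lop alg_space) phi phiM)
    (GRing.Linear.class phi).
exists l => s; rewrite -phiE /=; congr (phi _).
by rewrite /ncvar fmuE.
Qed.

(** Both representations of both families are by left multiplications on the
    algebra: only moments matter, and left and right operators of one family
    need not commute. *)
Lemma comb_bi_free_bi_free : comb_bi_free z' z'' -> bi_free z' z''.
Proof.
move=> czz.
have /choice[l lP] : forall d, exists l : {lrmorphism ncpoly K I -> Lop alg_space},
    forall i, l (ncvar K i) = lmul (fam z' z'' d (inl i)).
  by move=> d; exact: lmul_hom.
have /choice[r rP] : forall d, exists r : {lrmorphism ncpoly K J -> Lop alg_space},
    forall j, r (ncvar K j) = lmul (fam z' z'' d (inr j)).
  by move=> d; exact: lmul_hom.
exists (fun _ => alg_space), l, r => s.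
pose T (d : bool) (k : I + J) : Lop alg_space := lmul (fam z' z'' d k).
pose f (W : seq letter) : K := if monochrome fst W then word_kappa side z W else 0.
have f_monochrome W : ~~ monochrome fst W -> f W = 0 by rewrite /f => /negbTE->.
have repE (a : letter) :
    rep_op (X := fun _ => alg_space) side T a = rep_family (X := fun _ => alg_space) l r a.1 a.2.
  by case: a => d [i|j]; rewrite /rep_op /= ?lP ?rP.
have f_moments d m (y : 'I_m -> I + J) : (0 < m)%N ->
    pstate (\prod_(i < m) T d (y i)) = \sum_(pi in BNC (fun i => side (d, y i)))
      \prod_(V in pi) f (block_word (fun i => (d, y i)) V).
  move=> m0; rewrite pstate_lmul (moment_cumulant (fun i => side (d, y i)) _ m0).
  apply: eq_bigr => pi piB; apply: eq_bigr => V Vpi.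
  by rewrite /f (@monochrome_block _ _ _ d) // word_kappa_block.
case: s => [|a s]; first by rewrite !big_nil nc_state1 pstate1.
pose x := tnth (in_tuple (a :: s)).
have sE : a :: s = [seq x i | i <- enum 'I_(size (a :: s))] by rewrite map_tnth_enum.
rewrite {1}sE [in RHS]sE !prod_map_ord.
under eq_bigr do rewrite -repE.
rewrite (moment_formula (X := fun _ => alg_space) f_monochrome f_moments).
rewrite (moment_cumulant (side \o x) (z \o x)) //.
apply: eq_bigr => pi piB; apply: eq_bigr => V Vpi; rewrite /f.
case: ifP => [_|nm]; first by rewrite word_kappa_block.
rewrite /restr.
have V0 : (0 < #|V|)%N.
  rewrite card_gt0; move: piB; rewrite inE => /andP[/and3P[_ _ +] _].
  by apply: contraNneq => <-.
symmetry.
apply: (czz _ (fun t => (x (enum_val t)).2) _ (fun t => (x (enum_val t)).1) V0) => //.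
move=> -[d xd].
move/negP: nm; apply; rewrite block_word_map /monochrome -map_comp.
case: (enum _) => //= t ts; rewrite /restr xd; apply/allP => _ /mapP[u _ ->].
by rewrite /= xd.
Qed.
End BiFreeness.

Theorem theorem4p3p1 (R : realType) (A : ncspace R[i]) (I J : choiceType)
    (z' z'' : two_faced A I J) :
  bi_free z' z'' <-> comb_bi_free z' z''.
Proof. by split; [exact: bi_free_comb|exact: comb_bi_free_bi_free]. Qed.
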